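(* Let $r\ge 2$, $\ell\ge 2$, and let $m,m_1,\ldots,m_\ell\in\mathbb{N}$ be such that $q:=\lfloor(m_i-1)/r\rfloor$ does not depend on $i$. Set $a:=(\ell-1)r$, $m':=\sum_{i=1}^\ell m_i$, and $c:=ma+qr+1$. (i) The multi-arrangement $(\mathcal{A},\mu)$ in $\mathbb{C}^\ell$ with defining polynomial $$Q(\mathcal{A},\mu)=x_1^{m_1}\cdots x_\ell^{m_\ell}\prod_{1\le i<j\le\ell}(x_i^r-x_j^r)^{2m}$$ is free with exponents $$\exp(\mathcal{A},\mu)=\{ma+m_1,\ldots,ma+m_\ell\}.$$ (ii) The multi-arrangement $(\mathcal{A},\mu)$ in $\mathbb{C}^\ell$ with defining polynomial $$Q(\mathcal{A},\mu)=x_1^{m_1}\cdots x_\ell^{m_\ell}\prod_{1\le i<j\le\ell}(x_i^r-x_j^r)^{2m+1}$$ is free with exponents $$\exp(\mathcal{A},\mu)=\{c+m'-\ell(qr+1),\ c+r,\ c+2r,\ \ldots,\ c+(\ell-1)r\}$$ $$=\{(m-q)a+m'-\ell+1,\ ma+(q+1)r+1,\ ma+(q+2)r+1,\ \ldots,\ ma+(q+\ell-1)r+1\}.$$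
   Context: $\mathbb{N}=\{0,1,2,\ldots\}$. Let $S=\mathbb{C}[x_1,\ldots,x_\ell]$ and $\mathrm{Der}_S$ the $S$-module of $\mathbb{C}$-derivations of $S$. A derivation $\theta=\sum f_i\partial_{x_i}$ is homogeneous with $\mathrm{pdeg}\,\theta=p$ if all $f_i$ are homogeneous of degree $p$ (or zero). A multi-arrangement $(\mathcal{A},\mu)$ is a finite set $\mathcal{A}$ of hyperplanes $H=\ker(\alpha_H)$ through $0$ in $\mathbb{C}^\ell$ with a multiplicity function $\mu:\mathcal{A}\to\mathbb{N}$; its defining polynomial is $Q(\mathcal{A},\mu)=\prod_{H\in\mathcal{A}}\alpha_H^{\mu(H)}$ (which determines it up to hyperplanes of multiplicity $0$). Its module of derivations is $\mathfrak{D}(\mathcal{A},\mu)=\{\theta\in\mathrm{Der}_S\mid\theta(\alpha_H)\in S\alpha_H^{\mu(H)}\text{ for all }H\in\mathcal{A}\}$. $(\mathcal{A},\mu)$ is free if $\mathfrak{D}(\mathcal{A},\mu)$ is a free $S$-module; then there is a homogeneous basis $\theta_1,\ldots,\theta_\ell$, and $\exp(\mathcal{A},\mu)$ is the (well-defined) multiset $\{\mathrm{pdeg}\,\theta_1,\ldots,\mathrm{pdeg}\,\theta_\ell\}$. *)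

(* Defs.v *)
From HB Require Import structures.
From mathcomp Require Import all_boot all_order all_algebra.
From mathcomp Require Import finmap mpoly complex reals.

Set Implicit Arguments.
Unset Strict Implicit.
Unset Printing Implicit Defensive.

Import Order.TTheory GRing.Theory Num.Theory.
Local Open Scope ring_scope.

(* The linear form of H is part of the data, so that the defining polynomial
   is determined on the nose and not only up to a nonzero scalar.  The values
   of [form] and [mult] outside of [hyps] are irrelevant. *)
Record multiarrangement (K : fieldType) (l : nat) := MultiArrangement {
  hyps : {fset {vspace 'rV[K]_l}};
  form : {vspace 'rV[K]_l} -> {mpoly K[l]};
  mult : {vspace 'rV[K]_l} -> nat;
  form_homog : forall H, H \in hyps -> form H \is 1.-homog;
  form_neq0 : forall H, H \in hyps -> form H != 0;
  form_ker : forall H, H \in hyps ->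
    forall v : 'rV[K]_l, (v \in H) = ((form H).@[fun i => v 0 i] == 0)
}.

Definition defining_poly (K : fieldType) (l : nat)
    (A : multiarrangement K l) : {mpoly K[l]} :=
  \prod_(H <- hyps A) form A H ^+ mult A H.

Definition is_derivation (K : fieldType) (l : nat)
    (theta : {linear {mpoly K[l]} -> {mpoly K[l]}}) : Prop :=
  forall f g, theta (f * g) = theta f * g + f * theta g.

(* The coefficient of d/dx_i in theta is theta x_i; recall that
   0 is p.-homog for every p. *)
Definition has_pdeg (K : fieldType) (l : nat)
    (theta : {linear {mpoly K[l]} -> {mpoly K[l]}}) (p : nat) : Prop :=
  forall i : 'I_l, theta 'X_i \is p.-homog.

Definition in_derivation_module (K : fieldType) (l : nat)
    (A : multiarrangement K l)
    (theta : {linear {mpoly K[l]} -> {mpoly K[l]}}) : Prop :=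
  is_derivation theta /\
  forall H, H \in hyps A ->
    exists g : {mpoly K[l]}, theta (form A H) = g * form A H ^+ mult A H.

(* The S-module structure on derivations is the pointwise one. *)
Definition is_module_basis (K : fieldType) (l : nat)
    (A : multiarrangement K l) (n : nat)
    (theta : 'I_n -> {linear {mpoly K[l]} -> {mpoly K[l]}}) : Prop :=
  (forall k, in_derivation_module A (theta k)) /\
  forall eta, in_derivation_module A eta ->
    exists! p : {ffun 'I_n -> {mpoly K[l]}},
      forall f, eta f = \sum_(k < n) p k * theta k f.

(* Only finite bases are considered: the module is finitely generated, being
   a submodule of Der_S = S^l with S Noetherian. *)
Definition is_free (K : fieldType) (l : nat)
    (A : multiarrangement K l) : Prop :=
  exists n, exists theta : 'I_n -> {linear {mpoly K[l]} -> {mpoly K[l]}},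
    is_module_basis A theta.

(* The multiset of exponents is given by a list up to permutation, of integers
   because formulas for exponents may involve negative intermediate terms. *)
Definition has_exponents (K : fieldType) (l : nat)
    (A : multiarrangement K l) (es : seq int) : Prop :=
  exists theta : 'I_l -> {linear {mpoly K[l]} -> {mpoly K[l]}},
  exists d : 'I_l -> nat,
    [/\ is_module_basis A theta,
        forall k, has_pdeg (theta k) (d k)
      & perm_eq [seq (d k)%:Z | k <- enum 'I_l] es].

Definition multi_poly (K : fieldType) (l r : nat) (ms : 'I_l -> nat)
    (e : nat) : {mpoly K[l]} :=
  (\prod_(i < l) 'X_i ^+ ms i) *
  \prod_(i < l) \prod_(j < l | (i < j)%N) ('X_i ^+ r - 'X_j ^+ r) ^+ e.

(* Main.v *)
Require Import Defs.
From HB Require Import structures.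
From mathcomp Require Import all_boot all_order all_algebra.
From mathcomp Require Import finmap mpoly complex reals.
From mathcomp Require Import separable cyclotomic cyclic.
From mathcomp Require Import ring zify.
(* again, since all_algebra has another [form] *)
Import Defs.

Set Implicit Arguments.
Unset Strict Implicit.
Unset Printing Implicit Defensive.

Import Order.TTheory GRing.Theory Num.Theory.
Local Open Scope ring_scope.

(* Put y_i = x_i^r, let N = q + 1 and, for a polynomial E in t^r, let F be the
   antiderivative of t^((s-m-1)r) E(t) with exponents congruent to 1 modulo r
   (there is no logarithm, as r >= 2). For E = t^(Nr) \prod_i (t^r - y_i)^m the
   derivation with coefficients F(x_j) lies in the module of case (ii) for
   s >= 1: since F(zeta t) = zeta F(t), the difference F(x_i) - zeta F(x_j) is
   the integral of F' from zeta x_j to x_i, and F' vanishes to order m at both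
   ends, which gives the order 2m + 1; the order at x_j = 0 is at least
   (N+s-1)r + 1. The case s = 0 is repaired by the factor
   \prod_i x_i^(m_i - qr - 1). For case (i), take s = 1 and divide E by
   t^r - y_i, with the factor x_i^(m_i - qr - 1). By Saito's criterion it
   remains to see that the determinants are nonzero, which is checked at a point
   x off all the hyperplanes: a linear relation between the rows gives a nonzero
   F as above which vanishes at all x_j, hence to order m + 1 (resp. m) there
   because F' vanishes to order m (resp. m - 1), and this exceeds the degree
   of F. *)

(** * Antiderivatives *)

(* With w n = 1 / (r n - e), [(wint w E).[x ^+ r]] is x^e times the value at x
   of the antiderivative of t^(-e-1) E(t^r). *)
Definition wint (R : comNzRingType) (w : nat -> R) (E : {poly R}) : {poly R} :=
  \poly_(i < size E) (w i * E`_i).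

Section WeightedPoly.
Variable R : comNzRingType.
Implicit Types (w : nat -> R) (E : {poly R}).

Lemma coef_wint w E i : (wint w E)`_i = w i * E`_i.
Proof.
by rewrite coef_poly; case: ltnP => // le_Ei; rewrite nth_default ?mulr0.
Qed.

Lemma size_wint w E : (size (wint w E) <= size E)%N.
Proof. exact: size_poly. Qed.

Lemma wint_is_linear w : linear (wint w).
Proof.
move=> a E1 E2; apply/polyP=> i.
by rewrite !(coefD, coefZ, coef_wint) mulrDr mulrCA.
Qed.

HB.instance Definition _ w :=
  GRing.isLinear.Build R {poly R} {poly R} _ (wint w) (wint_is_linear w).

Lemma wint_XnM w n E :
  wint w ('X^n * E) = 'X^n * wint (fun i => w (n + i)%N) E.
Proof.
apply/polyP=> i; rewrite !(coef_wint, coefXnM).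
by case: ltnP => [|le_ni]; rewrite ?mulr0 ?coef_wint ?subnKC.
Qed.

Lemma wint_suml (I : Type) (s : seq I) (a : I -> R) (w : I -> nat -> R) E :
  wint (fun n => \sum_(i <- s) a i * w i n) E = \sum_(i <- s) a i *: wint (w i) E.
Proof.
apply/polyP=> n; rewrite coef_wint coef_sum mulr_suml.
by apply: eq_bigr => i _; rewrite coefZ coef_wint mulrA.
Qed.

(** In the binomial expansion of (X - y)^mu the term of index i shifts the weights by A + i and
    leaves y^(mu - i) behind, so at X = y all terms carry the same power of y. This exposes the
    order of the coefficients at x_j = 0. *)
Lemma wint_factor w A mu E y :
  (wint w ('X^A * (('X - y%:P) ^+ mu * E))).[y] =
  y ^+ (A + mu) *
  (wint (fun n => \sum_(i < mu.+1)
                    'C(mu, i)%:R * (-1) ^+ (mu - i) * w (A + i + n)%N) E).[y].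
Proof.
rewrite wint_suml addrC -polyCN exprDn mulr_suml mulr_sumr !linear_sum /=.
rewrite !horner_sum mulr_sumr; apply: eq_bigr => i _.
rewrite hornerZ.
have -> : 'X^A * ((- y)%:P ^+ (mu - i) * 'X^i *+ 'C(mu, i) * E) =
          ((- y) ^+ (mu - i) *+ 'C(mu, i)) *: ('X^(A + i) * E).
  rewrite -mul_polyC polyCMn polyC_exp exprD -[_ *+ 'C(_, _)]mulr_natr.
  rewrite -[_ *+ 'C(_, _) in RHS]mulr_natr; ring.
rewrite linearZ /= wint_XnM !hornerE (exprNn y).
have le_i : (i <= mu)%N by rewrite -ltnS.
have -> : y ^+ (A + mu) = y ^+ (A + i) * y ^+ (mu - i).
  by rewrite -exprD -addnA subnKC.
by rewrite -[_ *+ 'C(_, _)]mulr_natr /=; ring.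
Qed.

Lemma eq_wint w1 w2 E : w1 =1 w2 -> wint w1 E = wint w2 E.
Proof. by move=> w12; apply/polyP=> i; rewrite !coef_wint w12. Qed.

End WeightedPoly.

Lemma map_wint (R S : comNzRingType) (f : {rmorphism R -> S}) w E :
  map_poly f (wint w E) = wint (f \o w) (map_poly f E).
Proof. by apply/polyP=> i; rewrite !(coef_map, coef_wint) /= rmorphM. Qed.

(** * Order of vanishing and the Euler operator *)

Section Vanishing.
Variable K : numFieldType.

(** Write P = G (X - a)^(n+1) by induction; the hypothesis then makes (n + 1) X G divisible by X -
    a, and both n + 1 and a are nonzero. The operator X d/dX + k replaces the derivative because
    antiderivatives appear multiplied by a power of the variable. *)
Lemma euler_op_order (a k : K) n (P : {poly K}) :
  a != 0 -> P.[a] = 0 -> ('X - a%:P) ^+ n %| 'X * P^`() + k *: P ->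
  ('X - a%:P) ^+ n.+1 %| P.
Proof.
move=> a0 Pa; elim: n => [_|n IH dvdP].
  by rewrite expr1 dvdp_XsubCl; apply/rootP.
have /dvdpP[G PG] : ('X - a%:P) ^+ n.+1 %| P.
  by apply: IH; apply: dvdp_trans dvdP; rewrite exprS dvdp_mull.
suff dvdG : 'X - a%:P %| G by rewrite PG exprS dvdp_mul.
have Xn0 : ('X - a%:P) ^+ n != 0 by rewrite expf_neq0 ?polyXsubC_eq0.
move: dvdP; have -> : 'X * P^`() + k *: P =
  ('X - a%:P) ^+ n * (n.+1%:R *: ('X * G) + ('X - a%:P) * ('X * G^`() + k *: G)).
  rewrite PG derivM deriv_exp derivXsubC -!mul_polyC polyC_natr /=.
  by rewrite exprS -[_ *+ n.+1]mulr_natr; ring.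
rewrite exprSr dvdp_mul2l // dvdp_addl ?dvdp_mulIl // dvdpZr ?pnatr_eq0 //.
by rewrite !dvdp_XsubCl rootM rootX (negPf a0).
Qed.

End Vanishing.

(** * Divisibility in commutative rings *)

Definition rdvd (R : comNzRingType) (a b : R) : Prop := exists c, b = c * a.

Section RDvd.
Variable R : comNzRingType.
Implicit Types a b c : R.

Lemma rdvd_refl a : rdvd a a.
Proof. by exists 1; rewrite mul1r. Qed.

Lemma rdvd_trans b a c : rdvd a b -> rdvd b c -> rdvd a c.
Proof. by move=> [x ->] [y ->]; exists (y * x); rewrite mulrA. Qed.

Lemma rdvd_mull c a b : rdvd a b -> rdvd a (c * b).
Proof. by move=> [x ->]; exists (c * x); rewrite mulrA. Qed.

Lemma rdvd_mulr c a b : rdvd a b -> rdvd a (b * c).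
Proof. by rewrite mulrC; apply: rdvd_mull. Qed.

Lemma rdvd0 a : rdvd a 0.
Proof. by exists 0; rewrite mul0r. Qed.

Lemma rdvdD a b c : rdvd a b -> rdvd a c -> rdvd a (b + c).
Proof. by move=> [x ->] [y ->]; exists (x + y); rewrite mulrDl. Qed.

Lemma rdvd_sum (I : Type) (s : seq I) (P : pred I) (F : I -> R) a :
  (forall i, P i -> rdvd a (F i)) -> rdvd a (\sum_(i <- s | P i) F i).
Proof. by move=> aF; apply: big_ind => //; [apply: rdvd0 | apply: rdvdD]. Qed.

Lemma rdvd_exp_le a m n : (m <= n)%N -> rdvd (a ^+ m) (a ^+ n).
Proof. by move=> le_mn; exists (a ^+ (n - m)); rewrite -exprD subnK. Qed.

End RDvd.

(** * Homogenization of polynomials in one variable *)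

Section Homogenization.
Variables (K : fieldType) (S : comAlgType K) (a b : S).

(** For P of degree at most d this is b^d P(a / b), written without division. *)
Definition homogenize d (P : {poly K}) : S :=
  \sum_(c < d.+1) P`_c *: (a ^+ c * b ^+ (d - c)).

Lemma homogenize_is_linear d : linear (homogenize d).
Proof.
move=> k P Q; rewrite /homogenize scaler_sumr -big_split /=.
by apply: eq_bigr => c _; rewrite coefD coefZ scalerDl scalerA.
Qed.

HB.instance Definition _ d :=
  GRing.isLinear.Build K {poly K} S _ (homogenize d) (homogenize_is_linear d).

Lemma homogenizeXn d c : (c <= d)%N -> homogenize d 'X^c = a ^+ c * b ^+ (d - c).
Proof.
rewrite -ltnS => lt_cd; rewrite /homogenize (bigD1 (Ordinal lt_cd)) //=.
rewrite coefXn eqxx scale1r big1 ?addr0 // => i ne_i.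
by rewrite coefXn -[_ == c]/(i == Ordinal lt_cd) (negPf ne_i) scale0r.
Qed.

Lemma homogenize_XsubCM d (c : K) (P : {poly K}) : (size P <= d.+1)%N ->
  homogenize d.+1 (('X - c%:P) * P) = (a - c *: b) * homogenize d P.
Proof.
move=> szP; have -> : P = \sum_(n < d.+1) P`_n *: 'X^n.
  rewrite -poly_def; apply/polyP=> i; rewrite coef_poly; case: ltnP => // le_i.
  by rewrite nth_default // (leq_trans szP).
rewrite mulr_sumr !linear_sum mulr_sumr; apply: eq_bigr => n _ /=.
rewrite -scalerAr !linearZ /= -scalerAr; congr (_ *: _).
have -> : ('X - c%:P) * 'X^n = ('X^(n.+1)) - (c *: ('X^n)) :> {poly K}.
  by rewrite mulrBl -exprS mul_polyC.
have le_nd : (n <= d)%N by rewrite -ltnS.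
rewrite linearB linearZ /= !homogenizeXn // ?leqW // subSS subSn // !exprS.
by rewrite scalerN mulrBl -scalerAl; congr (_ - _ *: _); ring.
Qed.

Lemma homogenize_prod_XsubC (cs : seq K) :
  homogenize (size cs) (\prod_(c <- cs) ('X - c%:P)) = \prod_(c <- cs) (a - c *: b).
Proof.
elim: cs => [|c cs IH].
  by rewrite !big_nil -(expr0 'X) homogenizeXn // subn0 !expr0 mulr1.
by rewrite !big_cons /= homogenize_XsubCM ?size_prod_XsubC // IH.
Qed.

(** Each factor X - 1 of P becomes a factor a - b and uses up one degree. *)
Lemma homogenize_dvd d k (P : {poly K}) : (size P <= d.+1)%N -> ('X - 1%:P) ^+ k %| P ->
  rdvd ((a - b) ^+ k) (homogenize d P).
Proof.
elim: k d P => [|k IH] d P szP; first by exists (homogenize d P); rewrite mulr1.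
have [-> _|P0] := eqVneq P 0; first by rewrite linear0; apply: rdvd0.
case/dvdpP=> Q PQ; have {}PQ : P = ('X - 1%:P) * (Q * ('X - 1%:P) ^+ k).
  by rewrite PQ exprS mulrCA.
have Q0 : Q * ('X - 1%:P) ^+ k != 0.
  by apply: contraNneq P0 => Q0; rewrite PQ Q0 mulr0.
have szPQ : size P = (size (Q * ('X - 1%:P) ^+ k)%R).+1.
  by rewrite PQ [LHS]size_monicM ?monicXsubC // size_XsubC.
(* In degree 0 a nonzero P is constant and has no factor X - 1. *)
case: d szP => [|d] szP.
  by move: szP; rewrite szPQ ltnS leqn0 size_poly_eq0 (negPf Q0).
rewrite szPQ ltnS in szP.
rewrite PQ homogenize_XsubCM // scale1r.
have [g ->] := IH _ _ szP (dvdp_mulIr _ _).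
by exists g; rewrite exprS; ring.
Qed.

End Homogenization.

(** * Integrals between two zeros of the integrand *)

Section Interval.
Variable K : numFieldType.

(* For w n = 1 / (mu - M + r n) this is X^M times the integral from 1 to X of
   t^(mu-M-1) (t^r - X^r)^p (t^r - 1)^m. *)
Definition two_point_integral (w : nat -> K) (r mu M p m : nat) : {poly K} :=
  \sum_(i < p.+1) \sum_(j < m.+1)
     ('C(p, i)%:R * (-1) ^+ (p - i) * ('C(m, j)%:R * (-1) ^+ (m - j)) * w (i + j)%N)
     *: ('X^(mu + r * (p + j)) - 'X^(M + r * (p - i))).

(** X d/dX - M multiplies X^n by n - M, and mu + r (p + j) - M = (mu + r (i + j) - M) + r (p - i).
    The first summand cancels w; the second is the factor that the other monomial produces. *)
Lemma euler_two_point_term q w r mu M p i j : (i <= p)%N ->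
  w * ((mu + r * (i + j))%:R - M%:R) = 1 ->
  let T := (q * w) *: ('X^(mu + r * (p + j)) - 'X^(M + r * (p - i))) in
  'X * T^`() + - M%:R *: T =
  q *: 'X^(mu + r * (p + j)) + (r * (p - i))%:R *: T :> {poly K}.
Proof.
move=> le_ip wE /=.
have XdX n : 'X * ('X^n)^`() = n%:R *: 'X^n :> {poly K}.
  case: n => [|n]; first by rewrite derivC mulr0 scale0r.
  by rewrite derivXn /= mulrnAr -exprS scaler_nat.
rewrite derivZ derivB -scalerAr mulrBr !XdX !scalerBr !scalerA.
have -> : q * w * (mu + r * (p + j))%:R =
          q + (r * (p - i))%:R * (q * w) + M%:R * (q * w).
  have -> : (mu + r * (p + j) = (mu + r * (i + j)) + r * (p - i))%N.
    by rewrite -addnA -mulnDr addnAC subnKC.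
  transitivity (q * (w * ((mu + r * (i + j))%:R - M%:R)) +
                (r * (p - i))%:R * (q * w) + M%:R * (q * w)).
    by rewrite natrD; ring.
  by rewrite wE mulr1.
by rewrite natrD mulrDr !scalerDl -!mul_polyC !polyCM polyCN; ring.
Qed.

(** Induction on p, by differentiation under the integral sign: X d/dX - M sends the integral for p
    + 1 to - r (p + 1) X^r times the one for p, and the integral for p = 0 to X^mu (X^r - 1)^m. As
    the integral from 1 to X vanishes at X = 1, [euler_op_order] gains one order each time. *)
Lemma two_point_integral_dvd w r mu M p m :
  (forall n, w n * ((mu + r * n)%:R - M%:R) = 1) ->
  ('X - 1%:P) ^+ (p + m).+1 %| two_point_integral w r mu M p m.
Proof.
move=> wE; elim: p => [|p IH]; apply: (@euler_op_order _ _ (- M%:R)).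
- exact: oner_neq0.
- rewrite /two_point_integral horner_sum big1 // => i _; rewrite horner_sum big1 // => j _.
  by rewrite !hornerE !expr1n subrr mulr0.
- suff -> : 'X * (two_point_integral w r mu M 0 m)^`()
            + - M%:R *: two_point_integral w r mu M 0 m =
            'X^mu * ('X^r - 1) ^+ m.
    rewrite add0n dvdp_mull // dvdp_exp2r // dvdp_XsubCl.
    by rewrite rootE !hornerE expr1n subrr.
  rewrite /two_point_integral big_ord1 raddf_sum mulr_sumr scaler_sumr -big_split /=.
  rewrite addrC exprDn mulr_sumr; apply: eq_bigr => j _.
  rewrite euler_two_point_term // subnn muln0 scale0r addr0 bin0 !mul1r add0n.
  rewrite exprD exprM -mul_polyC polyCM polyC_natr polyC_exp polyCN.
  by rewrite -[_ *+ 'C(_, _)]mulr_natr; ring.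
- exact: oner_neq0.
- rewrite /two_point_integral horner_sum big1 // => i _; rewrite horner_sum big1 // => j _.
  by rewrite !hornerE !expr1n subrr mulr0.
- suff -> : 'X * (two_point_integral w r mu M p.+1 m)^`()
            + - M%:R *: two_point_integral w r mu M p.+1 m =
            - (r * p.+1)%:R *: ('X^r * two_point_integral w r mu M p m).
    by rewrite -mul_polyC !dvdp_mull.
  rewrite {1 2}/two_point_integral raddf_sum mulr_sumr scaler_sumr -big_split /=.
  under eq_bigr => i _.
    rewrite raddf_sum mulr_sumr scaler_sumr -big_split /=.
    under eq_bigr => j _ do rewrite (@euler_two_point_term _ _ _ _ M _ _ _ (leq_ord i) (wE _)).
    rewrite big_split /=; over.
  (* The boundary term at t = X carries the factor (t^r - X^r)^(p+1); in the expansion it vanishes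
     as the alternating binomial sum (-1 + 1)^(p+1). *)
  rewrite big_split /= exchange_big big1 ?add0r /=; last first.
    move=> j _; rewrite -scaler_suml -mulr_suml.
    have := exprDn (-1 : K) 1 p.+1; rewrite addNr expr0n => /esym sum0.
    suff -> : \sum_(i < p.+2) 'C(p.+1, i)%:R * (-1) ^+ (p.+1 - i) = 0 :> K.
      by rewrite mul0r scale0r.
    by rewrite -{}[RHS]sum0; apply: eq_bigr => i _; rewrite expr1n mulr1 mulr_natl.
  rewrite big_ord_recr /= [X in _ + X]big1 ?addr0; last first.
    by move=> j _; rewrite subnn muln0 scale0r.
  rewrite /two_point_integral mulr_sumr scaler_sumr; apply: eq_bigr => i _.
  rewrite mulr_sumr scaler_sumr; apply: eq_bigr => j _ /=.
  have le_ip : (i <= p)%N by rewrite -ltnS.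
  have -> : 'X^(mu + r * (p.+1 + j)) - 'X^(M + r * (p.+1 - i)) =
            'X^r * ('X^(mu + r * (p + j)) - 'X^(M + r * (p - i))) :> {poly K}.
    by rewrite subSn // addSn !mulnS !(addnCA _ r) !exprD; ring.
  rewrite -scalerAr !scalerA; congr (_ *: _).
  have binE : (p.+1 - i)%:R * 'C(p.+1, i)%:R = p.+1%:R * 'C(p, i)%:R :> K.
    by rewrite -!natrM -mul_bin_down.
  rewrite !natrM subSn // exprS in binE *.
  transitivity (r%:R * ((p - i).+1%:R * 'C(p.+1, i)%:R) *
    (- 1 * (-1) ^+ (p - i) * ('C(m, j)%:R * (-1) ^+ (m - j)) * w (i + j)%N)).
    ring.
  by rewrite binE; ring.
Qed.

End Interval.

Lemma wint_binomials (S : comNzRingType) (w : nat -> S) (y1 y2 y : S) p m n :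
  (wint w (('X - y1%:P) ^+ p * (('X - y2%:P) ^+ m * 'X^n))).[y] =
  \sum_(i < p.+1) \sum_(j < m.+1)
    'C(p, i)%:R * (-1) ^+ (p - i) * ('C(m, j)%:R * (-1) ^+ (m - j)) *
    w (n + (i + j))%N *
    (y1 ^+ (p - i) * y2 ^+ (m - j) * y ^+ (n + (i + j))).
Proof.
rewrite ![_ - _]addrC -!polyCN !exprDn mulr_suml linear_sum horner_sum.
apply: eq_bigr => i _.
rewrite mulr_suml mulr_sumr linear_sum horner_sum; apply: eq_bigr => j _.
have -> : (- y1)%:P ^+ (p - i) * 'X^i *+ 'C(p, i) *
          ((- y2)%:P ^+ (m - j) * 'X^j *+ 'C(m, j) * 'X^n) =
  (((- y1) ^+ (p - i) *+ 'C(p, i)) * ((- y2) ^+ (m - j) *+ 'C(m, j)))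
     *: 'X^(n + (i + j)).
  rewrite -mul_polyC polyCM !polyCMn !polyC_exp !exprD.
  rewrite -[_ *+ 'C(p, i)]mulr_natr -[_ *+ 'C(m, j)]mulr_natr.
  rewrite -[_ *+ 'C(p, i) in RHS]mulr_natr -[_ *+ 'C(m, j) in RHS]mulr_natr.
  ring.
rewrite linearZ /= hornerZ -[X in wint w X]mulr1 wint_XnM hornerM hornerXn.
have -> : (wint (fun k => w (n + (i + j) + k)%N) 1).[y] = w (n + (i + j))%N.
  have -> : wint (fun k => w (n + (i + j) + k)%N) 1 = (w (n + (i + j))%N)%:P.
    apply/polyP=> k; rewrite coef_wint coefC coef1.
    by case: eqP => [->|_]; rewrite ?mulr1 ?addn0 ?mulr0.
  by rewrite hornerC.
rewrite (exprNn y1) (exprNn y2) /=.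
rewrite -[_ *+ 'C(p, i)]mulr_natr -[_ *+ 'C(m, j)]mulr_natr /=.
ring.
Qed.

(** Up to the factor (a b)^e the difference is the integral of t^(-e-1) E(t^r) from b to a, whose
    integrand vanishes to order p at a and to order m at b. By linearity G may be taken to be X^n;
    the difference is then homogeneous in a and b, and at (X, 1) it becomes [two_point_integral]. *)
Lemma wint_difference_dvd (K : numFieldType) (S : comAlgType K) (w : nat -> K)
    (r e p m : nat) (a b : S) (G : {poly S}) :
  (forall n, w n * ((r * n)%:R - e%:R) = 1) ->
  let E := ('X - (a ^+ r)%:P) ^+ p * (('X - (b ^+ r)%:P) ^+ m * G) in
  let w' n := (w n)%:A in
  rdvd ((a - b) ^+ (p + m).+1)
       (b ^+ e * (wint w' E).[a ^+ r] - a ^+ e * (wint w' E).[b ^+ r]).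
Proof.
move=> wE E w'.
have -> : E = \sum_(n < size G) G`_n *:
    (('X - (a ^+ r)%:P) ^+ p * (('X - (b ^+ r)%:P) ^+ m * 'X^n)).
  rewrite /E -{1}[G]coefK poly_def !mulr_sumr; apply: eq_bigr => n _.
  by rewrite !scalerAr.
rewrite linear_sum !horner_sum !mulr_sumr -sumrB; apply: rdvd_sum => n _.
rewrite linearZ /= !hornerZ [b ^+ e * _]mulrCA [a ^+ e * _]mulrCA -mulrBr.
apply: rdvd_mull; rewrite !wint_binomials !mulr_sumr -sumrB.
pose D : {poly K} := two_point_integral (fun k => w (n + k)%N) r (r * n) e p m.
have leE (i : 'I_p.+1) (j : 'I_m.+1) : (i <= p)%N /\ (j <= m)%N.
  by rewrite !leq_ord.
(* The common degree in a and b of all the terms. *)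
pose d := (r * (n + p + m) + e)%N.
have le_d1 j : (j <= m)%N -> (r * n + r * (p + j) <= d)%N.
  move=> le_jm; rewrite -mulnDr /d; apply: leq_trans (leq_addr _ _).
  by rewrite leq_mul2l; apply/orP; right; lia.
have le_d2 i : (e + r * (p - i) <= d)%N.
  by rewrite /d addnC leq_add2r leq_mul2l; apply/orP; right; lia.
set X := (X in rdvd _ X); suff -> : X = homogenize a b d D.
  apply: homogenize_dvd.
    apply: (leq_trans (size_sum _ _ _)); apply/bigmax_leqP => i _.
    apply: (leq_trans (size_sum _ _ _)); apply/bigmax_leqP => j _.
    apply: (leq_trans (size_scale_leq _ _)).
    apply: (leq_trans (size_polyD _ _)); rewrite size_polyN !size_polyXn.
    have [le_ip le_jm] := leE i j.
    by rewrite geq_max !ltnS le_d1 // le_d2.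
  by apply: two_point_integral_dvd => k; rewrite -mulnDr.
rewrite linear_sum /X; apply: eq_bigr => i _.
rewrite !mulr_sumr -sumrB linear_sum; apply: eq_bigr => j _ /=.
have [le_ip le_jm] := leE i j.
rewrite linearZ linearB /= !homogenizeXn ?le_d1 //.
have -> : (d - (r * n + r * (p + j)) = r * (m - j) + e)%N.
  rewrite -mulnDr /d addnC -addnBA; last by rewrite leq_mul //; lia.
  by rewrite -mulnBr addnC; congr (_ * _ + _)%N; lia.
have -> : (d - (e + r * (p - i)) = r * (m + (n + i)))%N.
  by rewrite /d addnC subnDl -mulnBr; congr (_ * _)%N; lia.
have in_algE : ('C(p, i)%:R * (-1) ^+ (p - i) * ('C(m, j)%:R * (-1) ^+ (m - j)) *
    w (n + (i + j))%N)%:A = 'C(p, i)%:R * (-1) ^+ (p - i) *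
    ('C(m, j)%:R * (-1) ^+ (m - j)) * w' (n + (i + j))%N.
  by rewrite -[LHS]/(in_alg S _) !rmorphM !rmorphXn !rmorphN1 !rmorph_nat.
rewrite -[RHS]mulr_algl in_algE -!exprM !exprD.
have -> : a ^+ (r * n) * a ^+ (r * (p + j)) =
          a ^+ (r * (p - i)) * a ^+ (r * (n + (i + j))).
  by rewrite -!exprD -!mulnDr; congr (_ ^+ (_ * _)); lia.
have -> : b ^+ (r * (m + (n + i))) = b ^+ (r * (m - j)) * b ^+ (r * (n + (i + j))).
  by rewrite -!exprD -!mulnDr; congr (_ ^+ (_ * _)); lia.
ring.
Qed.

(** * Antiderivatives with too many zeros *)

Section Vanishing.
Variables (K : numFieldType) (l : nat) (y : 'I_l -> K).
Hypotheses (y_inj : injective y) (y_neq0 : forall i, y i != 0).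

Lemma prod_XsubC_exp_dvd m (G : {poly K}) :
  (forall j, ('X - (y j)%:P) ^+ m %| G) -> \prod_j ('X - (y j)%:P) ^+ m %| G.
Proof.
move=> dvdG; rewrite -big_enum /=; elim: (enum _) (enum_uniq 'I_l) => [|j s IH] /=.
  by rewrite big_nil dvd1p.
case/andP=> js us; rewrite big_cons Gauss_dvdp ?dvdG ?IH //.
rewrite coprimep_expl // coprimep_sym coprimep_XsubC rootE horner_prod.
rewrite prodf_seq_neq0; apply/allP=> i si /=.
rewrite horner_exp hornerXsubC expf_eq0 subr_eq0 (inj_eq y_inj).
by apply/nandP; right; apply: contraNneq js => ->.
Qed.

(** An Euler operator maps G = [wint w E] to a multiple of E, which vanishes to order m at each y_j,
    so the zeros y_j of G have order at least m + 1. These are l (m + 1) zeros, while the degree of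
    G is smaller than that. *)
Lemma wint_prod_eq0 r k m w (W : {poly K}) : (0 < r)%N ->
  (forall n, w n * (k + (r * n)%:R) = 1) -> (size W <= l)%N ->
  (forall j, (wint w (W * \prod_i ('X - (y i)%:P) ^+ m)).[y j] = 0) -> W = 0.
Proof.
move=> r_gt0 wE szW; set T := \prod_i _; set E := W * T => Gy.
have r0 : r%:R != 0 :> K by rewrite pnatr_eq0 -lt0n.
set G := wint w E in Gy.
(* With X = t^r the operator t d/dt becomes r X d/dX, hence the division by r. *)
have GE : 'X * G^`() + (r%:R^-1 * k) *: G = r%:R^-1 *: E.
  apply/polyP=> n; rewrite coefD coefXM coefZ.
  have -> : (if n == 0%N then 0 else G^`()`_n.-1) = n%:R * G`_n.
    by case: n => [|n] /=; rewrite ?mul0r // coef_deriv mulr_natl.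
  rewrite coef_wint coefZ.
  transitivity (r%:R^-1 * (w n * (k + (r * n)%:R) * E`_n)).
    by rewrite natrM; field.
  by rewrite wE mul1r.
have dvdT j : ('X - (y j)%:P) ^+ m %| T.
  by rewrite /T (bigD1 j) //= dvdp_mulIl.
have dvdG : \prod_j ('X - (y j)%:P) ^+ m.+1 %| G.
  apply: prod_XsubC_exp_dvd => j.
  apply: (euler_op_order (k := r%:R^-1 * k)) => //.
  by rewrite GE dvdpZr ?invr_eq0 // dvdp_mull.
have sz_prod n : size (\prod_j ('X - (y j)%:P) ^+ n) = (l * n).+1.
  rewrite size_prod => [|j _]; last by rewrite expf_neq0 ?polyXsubC_eq0.
  under eq_bigr => j _ do rewrite size_exp_XsubC.
  by rewrite sum_nat_const card_ord mulnS subSn ?leq_addr // addKn.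
have T0 : T != 0 by rewrite -size_poly_eq0 sz_prod.
apply/eqP/contraT => W0.
have szE : (size E <= l + l * m)%N.
  by rewrite size_mul // sz_prod addnS /= leq_add2r.
(* No weight is zero, so G = 0 would force E = 0. *)
have G0 : G != 0.
  apply: contra_neq (mulf_neq0 W0 T0) => G0.
  apply/polyP=> n; have /esym/eqP := coef_wint w E n.
  rewrite -/G G0 !coef0 mulf_eq0; have := wE n.
  by case: eqP => [->|_ _ /eqP //]; rewrite mul0r => /esym/eqP; rewrite oner_eq0.
have := dvdp_leq G0 dvdG; rewrite sz_prod => /leq_trans/(_ (size_wint w E)).
by move=> /leq_trans/(_ szE); rewrite mulnS ltnn.
Qed.

End Vanishing.

(** * Linear forms and Saito's criterion *)

Definition is_prime (R : comNzRingType) (a : R) : Prop :=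
  [/\ a != 0, ~ rdvd a 1 &
      forall f g, rdvd a (f * g) -> rdvd a f \/ rdvd a g].

Section PrimeElements.
Variable R : idomainType.
Implicit Types a b D : R.

Lemma rdvd_exp_prime a b D n : is_prime a -> ~ rdvd a b ->
  rdvd (a ^+ n) (b * D) -> rdvd (a ^+ n) D.
Proof.
case=> a0 _ aP nab; elim: n => [|n IH] dvd; first by exists D; rewrite mulr1.
have [] := IH; first by apply: rdvd_trans dvd; apply: rdvd_exp_le.
move=> c Dc; have [d bD] := dvd.
have /aP[//|[c' c'E]] : rdvd a (b * c).
  exists d; apply: (mulIf (expf_neq0 n a0)).
  by rewrite -mulrA -Dc bD exprS mulrA.
by exists c'; rewrite Dc c'E exprS mulrA.
Qed.

Lemma prime_rdvd_prod (I : eqType) (s : seq I) (P : pred I) (F : I -> R) a :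
  is_prime a -> rdvd a (\prod_(i <- s | P i) F i) ->
  exists i, [/\ i \in s, P i & rdvd a (F i)].
Proof.
case=> _ a1 aP; elim: s => [|j s IH]; rewrite ?big_nil // big_cons.
case: ifP => Pj => [/aP[aF|/IH] | /IH].
- by exists j; rewrite inE eqxx.
- by case=> i [si Pi aF]; exists i; rewrite inE si orbT.
- by case=> i [si Pi aF]; exists i; rewrite inE si orbT.
Qed.

Lemma prime_rdvd_exp a b n : is_prime a -> rdvd a (b ^+ n) ->
  (0 < n)%N /\ rdvd a b.
Proof.
case=> _ a1 aP; elim: n => [//|n IH]; rewrite exprS => /aP[//|/IH[] //].
Qed.

Lemma rdvd_prod_coprime (I : eqType) (s : seq I) (F : I -> R) (n : I -> nat) D :
  uniq s -> (forall i, i \in s -> is_prime (F i)) ->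
  (forall i j, i \in s -> j \in s -> rdvd (F i) (F j) -> i = j) ->
  (forall i, i \in s -> rdvd (F i ^+ n i) D) ->
  rdvd (\prod_(i <- s) F i ^+ n i) D.
Proof.
elim: s => [|i s IH] /= => [_ _ _ _|/andP[si us] Fpr Fcop FD].
  by rewrite big_nil; exists D; rewrite mulr1.
have [c Dc] : rdvd (\prod_(j <- s) F j ^+ n j) D.
  apply: IH => // [j js | j k js ks | j js]; [apply: Fpr|apply: Fcop|apply: FD];
  by rewrite inE ?js ?ks orbT.
rewrite big_cons; have is1 : i \in i :: s by rewrite inE eqxx.
have : rdvd (F i ^+ n i) (\prod_(j <- s) F j ^+ n j * c).
  by rewrite mulrC -Dc; apply: FD.
case/rdvd_exp_prime => [||d dE] //; first exact: Fpr.
  case/prime_rdvd_prod => [|j [js _]]; first exact: Fpr.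
  case/prime_rdvd_exp => [|_ dvdF]; first exact: Fpr.
  by move: si; rewrite (Fcop i j) ?js // inE js orbT.
by exists d; rewrite Dc dE; ring.
Qed.

End PrimeElements.

(** * Linear forms are prime *)

Section LinearForms.
Variables (K : fieldType) (l : nat).
Notation S := {mpoly K[l]}.
Implicit Types (f g p : S) (al be : S).

Lemma dhomog_msizeE d p : p != 0 -> p \is d.-homog -> msize p = d.+1.
Proof.
move=> p0 ph; have := dhomog_uniq p0 (dhomog_msize ph) ph.
have : (0 < msize p)%N by rewrite lt0n msize_poly_eq0.
by case: (msize p) => //= n _ ->.
Qed.

(** Degrees add up in a product, so g has degree 0. This turns divisibility of linear forms into
    proportionality, and later gives the scalar in Saito's criterion. *)
Lemma homog_quotient_const d p g f : p != 0 -> p \is d.-homog ->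
  f \is d.-homog -> p = g * f -> exists2 c : K, c != 0 & p = c *: f.
Proof.
move=> p0 ph fh pE.
have g0 : g != 0 by apply: contraNneq p0 => g0; rewrite pE g0 mul0r.
have f0 : f != 0 by apply: contraNneq p0 => f0; rewrite pE f0 mulr0.
have := msizeM g0 f0; rewrite -pE (dhomog_msizeE p0 ph) (dhomog_msizeE f0 fh).
rewrite addnS /= -[LHS]add1n => /addIn/esym sg.
have gE := msize1_polyC (eq_leq sg).
exists g@_0; first by rewrite gE mpolyC_eq0 in g0.
by rewrite pE {1}gE mul_mpolyC.
Qed.

Lemma linear_formE al : al \is 1.-homog -> al = \sum_i al@_(U_(i)) *: 'X_i.
Proof.
move=> alh; apply/mpolyP=> m; rewrite linear_sum /=.
have [/existsP[i /eqP->]|m1] := boolP [exists i : 'I_l, m == U_(i)%MM].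
  rewrite (bigD1 i) //= mcoeffZ mcoeffX eqxx mulr1 big1 ?addr0 // => j ne_ji.
  rewrite mcoeffZ mcoeffX -[_ == _]/(U_(j)%MM == U_(i)%MM).
  by rewrite eq_mnm1 (negPf ne_ji) mulr0.
rewrite (dhomog_nemf_coeff alh) ?mdeg_eq1 // big1 // => i _.
rewrite mcoeffZ mcoeffX; case: eqP => [mE|]; rewrite ?mulr0 //.
by case/existsP: m1; exists i; rewrite -mE.
Qed.

Lemma rdvd_prod_sub (I : Type) (s : seq I) (F G : I -> S) al :
  (forall i, rdvd al (F i - G i)) ->
  rdvd al (\prod_(i <- s) F i - \prod_(i <- s) G i).
Proof.
move=> FG; elim: s => [|i s IH]; first by rewrite !big_nil subrr; apply: rdvd0.
rewrite !big_cons.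
have -> : forall a b c d : S, a * b - c * d = a * (b - d) + d * (a - c).
  by move=> *; ring.
by apply: rdvdD; apply: rdvd_mull.
Qed.

(** The substitution [sg] solves al = 0 for the variable of index [i0]. It kills al and is the
    identity modulo al, so its kernel is the ideal of al; as its values lie in an integral domain,
    this ideal is prime. *)
Lemma linear_form_prime al : al \is 1.-homog -> al != 0 -> is_prime al.
Proof.
move=> alh al0; have [i0 ai0] : exists i, al@_(U_(i)) != 0.
  apply/existsP; apply: contraNT al0 => /existsPn a0.
  rewrite (linear_formE alh) big1 // => i _.
  by move/negPn/eqP: (a0 i) => ->; rewrite scale0r.
pose h i : S := 'X_i - (i == i0)%:R * ((al@_(U_(i0)))^-1 *: al).
pose sg f : S := f \mPo [tuple h i | i < l].
have sgX i : sg 'X_i = h i by rewrite /sg comp_mpolyXU -tnth_nth tnth_mktuple.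
have sg_al : sg al = 0.
  rewrite {1}(linear_formE alh) /sg linear_sum /=.
  under eq_bigr => i _ do rewrite comp_mpolyZ -/(sg _) sgX scalerBr.
  rewrite sumrB -(linear_formE alh) (bigD1 i0) //= eqxx mul1r scalerA mulfV //.
  by rewrite scale1r big1 ?addr0 ?subrr // => i /negPf->; rewrite mul0r scaler0.
have congr_sg f : rdvd al (f - sg f).
  have -> : f - sg f = \sum_(m <- msupp f) f@_m *: ('X_[m] - sg 'X_[m]).
    under eq_bigr => m _ do rewrite scalerBr /sg -comp_mpolyZ.
    by rewrite sumrB -mpolyE -linear_sum -mpolyE.
  apply: rdvd_sum => m _; rewrite -mul_mpolyC.
  apply: rdvd_mull; rewrite /sg comp_mpolyX mpolyXE_id; apply: rdvd_prod_sub => i.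
  rewrite tnth_mktuple; elim: (m i) => [|n IH]; first by rewrite subrr; apply: rdvd0.
  rewrite !exprS; have -> : 'X_i * 'X_i ^+ n - h i * h i ^+ n =
    'X_i * ('X_i ^+ n - h i ^+ n) + h i ^+ n * ('X_i - h i) by ring.
  apply: rdvdD; apply: rdvd_mull => //.
  rewrite /h opprB addrC subrK -mul_mpolyC mulrA.
  by apply: rdvd_mull; apply: rdvd_refl.
have alP f : rdvd al f <-> sg f = 0.
  split=> [[g ->]|sgf]; last by have := congr_sg f; rewrite sgf subr0.
  by rewrite /sg rmorphM /= -!/(sg _) sg_al mulr0.
split=> //.
  by move/alP/eqP; rewrite /sg rmorph1 oner_eq0.
move=> f g /alP/eqP; rewrite /sg rmorphM mulf_eq0.
by case/orP=> /eqP/alP; [left | right].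
Qed.

Lemma rdvd_linear_form al be : al \is 1.-homog -> be \is 1.-homog -> be != 0 ->
  rdvd al be -> exists2 c : K, c != 0 & be = c *: al.
Proof. by move=> alh beh be0 [g beE]; exact: (homog_quotient_const be0 beh alh beE). Qed.

End LinearForms.

(** * Derivations and determinants *)

Section Derivations.
Variables (K : fieldType) (l : nat).
Notation S := {mpoly K[l]}.
Implicit Types (f g p : S) (al be : S) (F : 'I_l -> S).

Definition der_of F g : S := \sum_i F i * g^`M(i).

Lemma der_of_is_linear F : linear (der_of F).
Proof.
move=> c f g; rewrite /der_of scaler_sumr -big_split /=.
by apply: eq_bigr => i _; rewrite mderivD mderivZ mulrDr scalerAr.
Qed.

HB.instance Definition _ F :=
  GRing.isLinear.Build K S S _ (der_of F) (der_of_is_linear F).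

Lemma der_of_is_derivation F : is_derivation (der_of F).
Proof.
move=> f g; rewrite /= /der_of mulr_suml mulr_sumr -big_split /=.
by apply: eq_bigr => i _; rewrite mderivM; ring.
Qed.

Lemma der_ofX F i : der_of F 'X_i = F i.
Proof.
rewrite /der_of (bigD1 i) //= mderivX mnm1E eqxx scale1r.
rewrite -[X in (X - _)%MM]add0m addmK mpolyX0 mulr1.
rewrite big1 ?addr0 // => j ne_ji.
by rewrite mderivX mnm1E eq_sym (negPf ne_ji) scale0r mulr0.
Qed.

Lemma der_of_difference F c a b : der_of F ('X_a - c *: 'X_b) = F a - c *: F b.
Proof. by rewrite -!scaleNr !(addrC _ (- c *: _)) der_of_is_linear !der_ofX. Qed.

(** Both sides agree on the variables, hence on all monomials by the Leibniz rule. *)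
Lemma derivationE (theta : {linear S -> S}) f : is_derivation theta ->
  theta f = der_of (fun i => theta 'X_i) f.
Proof.
move=> der; pose D : {linear S -> S} := der_of (fun i => theta 'X_i).
rewrite -[RHS]/(D f).
have derD : is_derivation D by apply: der_of_is_derivation.
have one (d : {linear S -> S}) : is_derivation d -> d 1 = 0.
  move=> /(_ 1 1); rewrite !mulr1 mul1r -[LHS]addr0.
  by move=> /addrI/esym.
pose ok g := theta g = D g.
have ok1 : ok 1 by rewrite /ok !one.
have okM g h : ok g -> ok h -> ok (g * h).
  by rewrite /ok der derD => -> ->.
rewrite [f]mpolyE !linear_sum; apply: eq_bigr => m _; rewrite !linearZ /=.
congr (_ *: _); rewrite mpolyXE_id; apply: (big_ind ok) => // i _.
elim: (m i) => [//|n IH]; rewrite exprS; apply: okM => //.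
by rewrite /ok /D /= der_ofX.
Qed.

Lemma der_linear_form (theta : {linear S -> S}) al : al \is 1.-homog ->
  theta al = \sum_j al@_(U_(j)) *: theta 'X_j.
Proof.
move=> alh; rewrite {1}(linear_formE alh) linear_sum.
by apply: eq_bigr => j _; rewrite linearZ.
Qed.

(** Let a be the column of coefficients of al. Then adj(M) (M a) = det(M) a, all entries of M a are
    divisible by al^e, and some entry of a is a nonzero scalar. *)
Lemma rdvd_det (M : 'M[S]_l) al e : al \is 1.-homog -> al != 0 ->
  (forall k, rdvd (al ^+ e) (\sum_j al@_(U_(j)) *: M k j)) ->
  rdvd (al ^+ e) (\det M).
Proof.
move=> alh al0 dvdM.
have [i0 ai0] : exists i, al@_(U_(i)) != 0.
  apply/existsP; apply: contraNT al0 => /existsPn a0.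
  rewrite (linear_formE alh) big1 // => i _.
  by move/negPn/eqP: (a0 i) => ->; rewrite scale0r.
pose a := \col_j (al@_(U_(j)))%:MP_[l].
have /(congr1 (fun B : 'cV[S]_l => B i0 0)) : \adj M *m (M *m a) = \det M *: a.
  by rewrite mulmxA mul_adj_mx mul_scalar_mx.
rewrite !mxE => detE.
have -> : \det M = (al@_(U_(i0)))^-1 *: (\det M * (al@_(U_(i0)))%:MP_[l]).
  by rewrite mulrC mul_mpolyC scalerA mulVf // scale1r.
rewrite -detE -mul_mpolyC; apply: rdvd_mull; apply: rdvd_sum => k _.
apply: rdvd_mull; have := dvdM k; rewrite !mxE.
under eq_bigr => j _ do rewrite -mul_mpolyC mulrC.
by under [X in _ -> rdvd _ X]eq_bigr => j _ do rewrite mxE.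
Qed.

End Derivations.

(** * Saito's criterion *)

Section Arrangement.
Variables (K : fieldType) (l : nat) (A : multiarrangement K l).
Notation S := {mpoly K[l]}.
Implicit Types M : 'M[S]_l.

Lemma form_prime H : H \in hyps A -> is_prime (form A H).
Proof.
by move=> AH; apply: linear_form_prime; [apply: form_homog | apply: form_neq0].
Qed.

Lemma form_inj H H' : H \in hyps A -> H' \in hyps A ->
  rdvd (form A H) (form A H') -> H = H'.
Proof.
move=> AH AH'.
case/(rdvd_linear_form (form_homog AH) (form_homog AH') (form_neq0 AH')) => c c0 E.
apply/vspaceP=> v; rewrite (form_ker AH) (form_ker AH') E mevalZ mulf_eq0.
by rewrite (negPf c0).
Qed.

Lemma defining_poly_rdvd D :
  (forall H, H \in hyps A -> rdvd (form A H ^+ mult A H) D) ->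
  rdvd (defining_poly A) D.
Proof.
move=> AD; apply: (rdvd_prod_coprime (fset_uniq _) _ _ AD).
  exact: form_prime.
exact: form_inj.
Qed.

Lemma defining_poly_rdvd_det M :
  (forall k, in_derivation_module A (der_of (M k))) ->
  rdvd (defining_poly A) (\det M).
Proof.
move=> AM; apply: defining_poly_rdvd => H AH.
apply: rdvd_det; [exact: form_homog|exact: form_neq0|] => k.
have [_ /(_ H AH)[g gE]] := AM k; exists g; rewrite -gE.
rewrite (der_linear_form _ (form_homog AH)) /=.
by apply: eq_bigr => j _; rewrite der_ofX.
Qed.

(** By Cramer's rule the coordinates of eta are quotients by det M of determinants with one row
    replaced by eta. All rows of such a matrix lie in the module, so its determinant is divisible by
    the defining polynomial, which is det M up to a scalar. Uniqueness holds because det M is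
    nonzero. *)
Lemma saito_criterion M (c : K) : c != 0 -> \det M = c *: defining_poly A ->
  (forall k, in_derivation_module A (der_of (M k))) ->
  is_module_basis A (fun k => der_of (M k)).
Proof.
move=> c0 detM AM; split=> // eta [der_eta A_eta].
have Q0 : defining_poly A != 0.
  rewrite /defining_poly prodf_seq_neq0; apply/allP => H AH /=.
  by rewrite expf_neq0 // form_neq0.
have detM0 : \det M != 0 by rewrite detM scaler_eq0 negb_or c0.
pose y : 'rV[S]_l := \row_j eta 'X_j.
have QadjM k : exists p, (y *m \adj M) 0 k = p * \det M.
  pose N := \matrix_(i, j) if i == k then eta 'X_j else M i j.
  have -> : (y *m \adj M) 0 k = \det N.
    rewrite mxE (expand_det_row _ k); apply: eq_bigr => j _.
    have minorE : row' k (col' j N) = row' k (col' j M).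
      by apply/matrixP=> i1 j1; rewrite !mxE eq_sym (negPf (neq_lift _ _)).
    by rewrite /cofactor minorE !mxE eqxx.
  have [g ->] : rdvd (defining_poly A) (\det N).
    apply: defining_poly_rdvd_det => i.
    have [->|ne_ik] := eqVneq i k.
      split=> [|H AH]; first exact: der_of_is_derivation.
      have [g gE] := A_eta H AH; exists g; rewrite -gE.
      rewrite !(der_linear_form _ (form_homog AH)) /=.
      by apply: eq_bigr => j _; rewrite der_ofX mxE eqxx.
    split=> [|H AH]; first exact: der_of_is_derivation.
    have [_ /(_ H AH)[g gE]] := AM i; exists g; rewrite -gE.
    rewrite !(der_linear_form _ (form_homog AH)) /=.
    by apply: eq_bigr => j _; rewrite !der_ofX mxE (negPf ne_ik).
  exists (c^-1 *: g); rewrite detM -scalerAl -scalerAr scalerA mulVf //.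
  by rewrite scale1r.
have [p pE] : exists p : {ffun 'I_l -> S}, forall k, (y *m \adj M) 0 k = p k * \det M.
  have [p pE] := fin_all_exists QadjM.
  by exists [ffun k => p k] => k; rewrite ffunE.
pose row_of (p : {ffun 'I_l -> S}) : 'rV[S]_l := \row_k p k.
have solP (p' : {ffun 'I_l -> S}) :
    (forall f, eta f = \sum_k p' k * der_of (M k) f) <-> row_of p' *m M = y.
  split=> [E|E f].
    apply/rowP=> j; rewrite !mxE E; apply: eq_bigr => k _.
    by rewrite mxE der_ofX.
  rewrite (derivationE _ der_eta) /der_of.
  under eq_bigr => j _.
    have -> : eta 'X_j = \sum_k p' k * M k j.
      move/rowP/(_ j): E; rewrite !mxE => <-.
      by apply: eq_bigr => k _; rewrite mxE.
    rewrite mulr_suml; over.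
  rewrite exchange_big /=; apply: eq_bigr => k _.
  by rewrite mulr_sumr; apply: eq_bigr => j _; rewrite mulrA.
have row_ofP p' : row_of p' *m M = y -> p' = p.
  move=> E; apply/ffunP=> k; apply: (mulIf detM0); rewrite -pE -E -mulmxA.
  by rewrite mul_mx_adj mul_mx_scalar !mxE mulrC.
exists p; split=> [|p' /solP/row_ofP->//]; apply/solP.
have E : \det M *: row_of p = y *m \adj M.
  by apply/rowP=> k; rewrite pE !mxE mulrC.
apply/rowP=> j; apply: (mulfI detM0).
have := congr1 (fun B : 'rV[S]_l => (B *m M) 0 j) E.
rewrite -mulmxA mul_adj_mx mul_mx_scalar -scalemxAl !mxE => <-.
by [].
Qed.

End Arrangement.

Lemma dhomog_prod_seq (R : comNzRingType) (l : nat) (I : Type) (s : seq I)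
    (P : pred I) (F : I -> {mpoly R[l]}) (d : I -> nat) :
  (forall i, P i -> F i \is (d i).-homog) ->
  \prod_(i <- s | P i) F i \is (\sum_(i <- s | P i) d i).-homog.
Proof.
move=> Fd; elim/big_rec2: _ => [|i m p Pi]; first exact: dhomog1.
by move=> ph; apply: dhomogM => //; apply: Fd.
Qed.

Lemma dhomog_det (R : comNzRingType) (l n : nat) (M : 'M[{mpoly R[l]}]_n) d :
  (forall k j, M k j \is (d k).-homog) -> \det M \is (\sum_k d k).-homog.
Proof.
move=> Md; rewrite /determinant; apply: rpred_sum => s _.
rewrite -signr_odd mulr_sign.
by case: ifP => _; rewrite ?rpredN; apply: dhomog_prod_seq => k _.
Qed.

(** * Arrangements given by a product of linear forms *)

Section LinearFactors.
Variables (K : fieldType) (l : nat) (T : eqType) (s : seq T).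
Variables (be : T -> {mpoly K[l]}) (n : T -> nat).
Hypothesis s_uniq : uniq s.
Hypothesis be_homog : forall t, t \in s -> be t \is 1.-homog.
Hypothesis be_neq0 : forall t, t \in s -> be t != 0.
Hypothesis be_sep : forall t t', t \in s -> t' \in s -> t != t' ->
  exists2 v : 'I_l -> K, (be t).@[v] = 0 & (be t').@[v] != 0.

Lemma factor_inj t t' : t \in s -> t' \in s -> rdvd (be t) (be t') -> t = t'.
Proof.
move=> st st' [g gE]; apply/eqP/contraT => /(be_sep st st')[v be0].
by rewrite gE mevalM be0 mulr0 eqxx.
Qed.

Definition form_kernel (al : {mpoly K[l]}) : {vspace 'rV[K]_l} :=
  lker (linfun (mulmxr (\col_j al@_(U_(j))) : 'rV[K]_l -> 'rV[K]_1)).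

Lemma mem_form_kernel al (v : 'rV[K]_l) : al \is 1.-homog ->
  (v \in form_kernel al) = (al.@[fun i => v 0 i] == 0).
Proof.
move=> alh; rewrite memv_ker lfunE /=.
have -> : al.@[fun i => v 0 i] = (v *m \col_j al@_(U_(j))) 0 0.
  rewrite {1}(linear_formE alh) mxE linear_sum; apply: eq_bigr => j _ /=.
  by rewrite mevalZ mevalXU mxE mulrC.
apply/eqP/eqP => [-> | E]; first by rewrite mxE.
by apply/matrixP=> i j; rewrite !ord1 E mxE.
Qed.

Let kers := map (form_kernel \o be) s.

Lemma form_kernel_inj : {in s &, injective (form_kernel \o be)}.
Proof.
move=> t t' st st' /= E; apply/eqP/contraT => /(be_sep st st')[v be0].
have vE al : al.@[v] = al.@[fun i => (\row_j v j : 'rV[K]_l) 0 i].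
  by apply: meval_eq => i; rewrite mxE.
by rewrite vE -mem_form_kernel ?be_homog // -E mem_form_kernel ?be_homog // -vE be0 eqxx.
Qed.

Lemma filter_form_kernel t : t \in s ->
  [seq t' <- s | form_kernel (be t') == form_kernel (be t)] = [:: t].
Proof.
move=> st; rewrite -(filter_pred1_uniq s_uniq st); apply: eq_in_filter => t' st'.
by rewrite /= (inj_in_eq form_kernel_inj).
Qed.

(** The form and the multiplicity have to be functions of the hyperplane, so they are found by
    looking up the index with that kernel, unique by [be_sep]. The default of [head] is reached only
    outside the arrangement. *)
Lemma exists_arrangement :
  exists A : multiarrangement K l, defining_poly A = \prod_(t <- s) be t ^+ n t.
Proof.
pose hy := seq_fset tt kers.
pose fo H := head 0 [seq be t | t <- s & form_kernel (be t) == H].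
pose mu H := head 0%N [seq n t | t <- s & form_kernel (be t) == H].
have hyP H : H \in hy -> exists2 t, t \in s & H = form_kernel (be t).
  by rewrite seq_fsetE => /mapP.
have foE t : t \in s -> fo (form_kernel (be t)) = be t.
  by move=> st; rewrite /fo filter_form_kernel.
have muE t : t \in s -> mu (form_kernel (be t)) = n t.
  by move=> st; rewrite /mu filter_form_kernel.
have h1 H : H \in hy -> fo H \is 1.-homog.
  by move=> /hyP[t st ->]; rewrite foE ?be_homog.
have h2 H : H \in hy -> fo H != 0.
  by move=> /hyP[t st ->]; rewrite foE ?be_neq0.
have h3 H : H \in hy -> forall v : 'rV[K]_l, (v \in H) = ((fo H).@[fun i => v 0 i] == 0).
  by move=> /hyP[t st ->] v; rewrite foE ?mem_form_kernel ?be_homog.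
exists (MultiArrangement mu h1 h2 h3); rewrite /defining_poly /=.
have kers_uniq : uniq kers by rewrite map_inj_in_uniq //; apply: form_kernel_inj.
rewrite (perm_big kers) /=; last first.
  by rewrite -[X in perm_eq _ X](undup_id kers_uniq) sort_keys_perm.
rewrite big_map big_seq [RHS]big_seq; apply: eq_bigr => t st.
by rewrite /= foE ?muE.
Qed.

Variable A : multiarrangement K l.
Hypothesis AE : defining_poly A = \prod_(t <- s) be t ^+ n t.

(** Only the defining polynomial of [A] is given, so its forms must be recovered: by unique
    factorization, a form of positive multiplicity is proportional to some [be t], and its power
    divides [be t ^+ n t]. *)
Lemma in_derivation_module_factors F :
  (forall t, t \in s -> rdvd (be t ^+ n t) (der_of F (be t))) ->
  in_derivation_module A (der_of F).
Proof.
move=> dvdF; split=> [|H AH]; first exact: der_of_is_derivation.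
(* A hyperplane of multiplicity 0 may be absent from the factors, but it imposes no condition. *)
have [->|e_gt0] := posnP (mult A H).
  by exists (der_of F (form A H)); rewrite mulr1.
have fpr := form_prime AH.
have dvdQ : rdvd (form A H ^+ mult A H) (\prod_(t <- s) be t ^+ n t).
  rewrite -AE /defining_poly (big_rem H) //=.
  by apply: rdvd_mulr; apply: rdvd_refl.
have [t [st _ /(prime_rdvd_exp fpr)[_ dvd_t]]] : exists t,
    [/\ t \in s, true & rdvd (form A H) (be t ^+ n t)].
  apply: prime_rdvd_prod => //; apply: rdvd_trans dvdQ.
  by rewrite -{1}[form A H]expr1; apply: rdvd_exp_le.
have [c c0 tE] := rdvd_linear_form (form_homog AH) (be_homog st) (be_neq0 st) dvd_t.
have fE : form A H = c^-1 *: be t by rewrite tE scalerA mulVf // scale1r.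
rewrite {1}fE linearZ -/(rdvd _ _) /= -mul_mpolyC; apply: rdvd_mull.
apply: rdvd_trans (dvdF t st).
(* Cancel the product of the other factors, which the prime [form A H] does not divide. *)
move: dvdQ; rewrite (big_rem t) //= mulrC; apply: rdvd_exp_prime => //.
case/(prime_rdvd_prod fpr) => t' [st' _ /(prime_rdvd_exp fpr)[_ dvd_t']].
move: st'; rewrite (mem_rem_uniq _ s_uniq) inE => /andP[/eqP ne st'].
apply/ne/esym/factor_inj => //; apply: rdvd_trans dvd_t'; rewrite fE -mul_mpolyC.
by exists (c^-1)%:MP.
Qed.

(** The defining polynomial divides det M and both are homogeneous of degree the sum of the [d k],
    so they differ by a nonzero scalar and Saito's criterion applies. *)
Lemma exponents_of_matrix (M : 'M[{mpoly K[l]}]_l) (d : 'I_l -> nat) (es : seq int) :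
  (forall k t, t \in s -> rdvd (be t ^+ n t) (der_of (M k) (be t))) ->
  (forall k j, M k j \is (d k).-homog) ->
  \det M != 0 -> (\sum_k d k = \sum_(t <- s) n t)%N ->
  perm_eq [seq (d k)%:Z | k <- enum 'I_l] es ->
  is_free A /\ has_exponents A es.
Proof.
move=> dvdM Md detM0 sum_d perm_d.
have AM k : in_derivation_module A (der_of (M k)).
  by apply: in_derivation_module_factors => t st; apply: dvdM.
have [g gE] := defining_poly_rdvd_det AM.
have Qh : defining_poly A \is (\sum_k d k).-homog.
  rewrite AE sum_d big_seq [X in X.-homog]big_seq; apply: dhomog_prod_seq => t st.
  by rewrite -[X in X.-homog]mul1n dhomogMn ?be_homog.
have [c c0 detE] := homog_quotient_const detM0 (dhomog_det Md) Qh gE.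
have basis := saito_criterion c0 detE AM.
split; first by exists l, (fun k => der_of (M k)).
exists (fun k => der_of (M k)), d; split=> // k i /=.
by rewrite der_ofX.
Qed.

End LinearFactors.

(** * The arrangements of the theorem *)

(** Homogenize the factorization of X^r - 1 in degree r. *)
Lemma subXX_factor (K : fieldType) (S : comAlgType K) (r : nat) (z : K) (a b : S) :
  r.-primitive_root z -> a ^+ r - b ^+ r = \prod_(k < r) (a - z ^+ k *: b).
Proof.
move=> prim_z; pose cs := [seq z ^+ k | k <- index_iota 0 r].
have sz_cs : size cs = r by rewrite size_map size_iota subn0.
have := homogenize_prod_XsubC a b cs; rewrite sz_cs !big_map factor_Xn_sub_1 //.
rewrite big_mkord => <-; rewrite linearB /= homogenizeXn // subnn expr0 mulr1.
by rewrite -(expr0 'X) homogenizeXn // subn0 expr0 mul1r.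
Qed.

(** * Linear factors of the defining polynomial *)

Section ReflectionFactors.
Variables (K : fieldType) (l r : nat) (z : K) (ms : 'I_l -> nat) (e : nat).
Hypothesis prim_z : r.-primitive_root z.
Notation S := {mpoly K[l]}.
Notation T := ('I_l + 'I_l * 'I_l * 'I_r)%type.

Definition factor_form (t : T) : S :=
  match t with
  | inl i => 'X_i
  | inr (i, j, k) => 'X_i - z ^+ k *: 'X_j
  end.

Definition factor_mult (t : T) : nat :=
  match t with inl i => ms i | inr _ => e end.

Definition is_factor (t : T) : bool :=
  match t with inl _ => true | inr (i, j, _) => (i < j)%N end.

Definition factors : seq T := [seq t <- enum {: T} | is_factor t].

Lemma mem_factors t : (t \in factors) = is_factor t.
Proof. by rewrite mem_filter mem_enum andbT. Qed.

Lemma factors_uniq : uniq factors.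
Proof. by rewrite filter_uniq ?enum_uniq. Qed.

Lemma mpolyX_homog (i : 'I_l) : ('X_i : S) \is 1.-homog.
Proof. by rewrite dhomogX /= mdeg1. Qed.

Lemma factor_form_homog t : factor_form t \is 1.-homog.
Proof.
by case: t => [i|[[i j] k]] /=; rewrite ?rpredB ?dhomogZ ?mpolyX_homog.
Qed.

Lemma root_expr_neq0 k : z ^+ k != 0.
Proof.
rewrite expf_neq0 //; have r_gt0 := prim_order_gt0 prim_z.
apply: contra_eq_neq (prim_expr_order prim_z) => ->.
by rewrite expr0n gtn_eqF // eq_sym oner_eq0.
Qed.

Lemma factor_form_basis_vector (i j : 'I_l) (k : 'I_r) (p : 'I_l) : (i < j)%N ->
  ((factor_form (inr (i, j, k))).@[fun x => (x == p)%:R] != 0) = (p \in [:: i; j]).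
Proof.
move=> lt_ij; rewrite /= mevalB mevalZ !mevalXU !inE ![p == _]eq_sym.
case: (i =P p) lt_ij => [->|_] lt_ij.
  by rewrite -(val_eqE j p) gtn_eqF // mulr0 subr0 oner_eq0.
case: (j =P p) => _; rewrite ?mulr0 ?mulr1 sub0r oppr_eq0 ?eqxx //.
by rewrite root_expr_neq0.
Qed.

Lemma factor_form_pair_zero (i j : 'I_l) (k : 'I_r) : (i < j)%N ->
  (factor_form (inr (i, j, k))).@[fun x => if x == i then z ^+ k else 1] = 0.
Proof.
by move=> lt_ij; rewrite /= mevalB mevalZ !mevalXU eqxx -(val_eqE j i) gtn_eqF ?mulr1 ?subrr.
Qed.

(** If the first form is x_i, or if the forms belong to two different pairs of indices, some basis
    vector is a zero of the first form only. The remaining cases use the point with x_i = z^k and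
    all other coordinates 1. *)
Lemma factor_form_sep t t' : t \in factors -> t' \in factors -> t != t' ->
  exists2 v : 'I_l -> K, (factor_form t).@[v] = 0 & (factor_form t').@[v] != 0.
Proof.
rewrite !mem_factors; case: t t' => [i|[[i j] k]] [i'|[[i' j'] k']].
- move=> _ _ ne; exists (fun x => (x == i')%:R); rewrite /= !mevalXU ?eqxx ?oner_eq0 //.
  by rewrite -[_ == _]/(inl i == inl i' :> T) (negPf ne).
- move=> _ lt_ij' _; pose p := if i == i' then j' else i'.
  exists (fun x => (x == p)%:R).
    rewrite /= mevalXU /p; case: (i =P i') => [->|/eqP/negPf-> //].
    by rewrite -(val_eqE i' j') ltn_eqF.
  by rewrite factor_form_basis_vector // /p !inE; case: ifP; rewrite eqxx ?orbT.
- move=> lt_ij _ _; exists (fun x => if x == i then z ^+ k else 1).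
    exact: factor_form_pair_zero.
  by rewrite /= mevalXU; case: ifP; rewrite ?oner_eq0 ?root_expr_neq0.
- move=> lt_ij lt_ij' ne.
  have [/eqP[ii' jj']|ne_pair] := boolP ((i, j) == (i', j')).
    exists (fun x => if x == i then z ^+ k else 1).
      exact: factor_form_pair_zero.
    rewrite -ii' -jj' /= mevalB mevalZ !mevalXU eqxx -(val_eqE j i) gtn_eqF // mulr1 subr_eq0.
    rewrite (eq_prim_root_expr prim_z) !modn_small //.
    by apply: contraNneq ne => /val_inj->; rewrite ii' jj'.
  (* As i < j, i' < j' and the pairs differ, j' lies outside {i, j} whenever i' lies inside. *)
  pose p := if i' \in [:: i; j] then j' else i'.
  exists (fun x => (x == p)%:R); last first.
    by rewrite factor_form_basis_vector // /p !inE; case: ifP; rewrite eqxx ?orbT.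
  apply/eqP; rewrite -[_ == 0]negbK factor_form_basis_vector // /p.
  case: ifP => [|-> //]; rewrite !inE; move: ne_pair lt_ij lt_ij'.
  rewrite xpair_eqE -!val_eqE /=; lia.
Qed.

Lemma factor_form_neq0 t : t \in factors -> factor_form t != 0.
Proof.
rewrite mem_factors => lt_t.
suff [v v0] : exists v, (factor_form t).@[v] != 0.
  by apply: contraNneq v0 => ->; rewrite meval0.
case: t lt_t => [i _|[[i j] k] lt_ij].
  by exists (fun=> 1); rewrite /= mevalXU oner_eq0.
by exists (fun x => (x == i)%:R); rewrite factor_form_basis_vector // mem_head.
Qed.

Lemma multi_poly_factors :
  multi_poly K r ms e = \prod_(t <- factors) factor_form t ^+ factor_mult t.
Proof.
rewrite big_filter big_enum_cond /= big_sumType /=; congr (_ * _).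
rewrite pair_big_dep /=.
under eq_bigr => p _ do rewrite (subXX_factor _ _ prim_z) -prodrXl.
rewrite pair_big_dep /=.
rewrite [RHS](reindex_onto (fun p => p) (fun p => p)) //=.
by apply: eq_big => [[[i j] k]|[[i j] k]] //=; rewrite eqxx ?andbT.
Qed.

Lemma sum_factor_mult :
  (\sum_(t <- factors) factor_mult t = \sum_i ms i + e * r * 'C(l, 2))%N.
Proof.
rewrite big_filter big_enum_cond /= big_sumType /=; congr (_ + _)%N.
have -> : (\sum_(p : 'I_l * 'I_l * 'I_r | is_factor (inr p)) e =
           \sum_(i < l) \sum_(j < l | i < j) \sum_(k < r) e)%N.
  rewrite pair_big_dep pair_big_dep /=.
  by apply: eq_big => [[[i j] k]|[[i j] k]] //=; rewrite andbT.
under eq_bigr => i _.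
  rewrite (eq_bigr (fun=> r * e)%N) => [|j _]; last by rewrite sum_nat_const card_ord.
  rewrite -(big_geq_mkord _ _ xpredT (fun=> r * e)%N) sum_nat_const_nat; over.
rewrite -big_distrl /= mulnC [(r * e)%N]mulnC; congr (_ * _)%N.
rewrite -triangular_sum big_mkord (reindex_inj rev_ord_inj) /=.
by apply: eq_bigr => i _; rewrite subnSK // subKn // ltnW.
Qed.

End ReflectionFactors.

(** * Weighted homogeneity *)

Section WeightedHomogeneous.
Variables (R : comNzRingType) (l r : nat).
Notation S := {mpoly R[l]}.

(* Homogeneity of degree r d when the polynomial variable is given weight r. *)
Definition whomog d (p : {poly S}) : Prop :=
  forall n, (n <= d)%N && (p`_n \is (r * (d - n)).-homog) || (p`_n == 0).

Lemma whomog1 : whomog 0 1.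
Proof. by case=> [|n]; rewrite coef1 ?eqxx ?orbT // muln0 dhomog1. Qed.

Lemma whomogM d e p q : whomog d p -> whomog e q -> whomog (d + e) (p * q).
Proof.
move=> ph qh n; have [le_n|lt_n] /= := leqP n (d + e).
  apply/orP; left; rewrite coefM; apply: rpred_sum => i _.
  have le_in : (i <= n)%N by rewrite -ltnS.
  have /orP[/andP[le_id pi]|/eqP->] := ph i; last by rewrite mul0r rpred0.
  have /orP[/andP[le_je qj]|/eqP->] := qh (n - i)%N; last by rewrite mulr0 rpred0.
  have -> : (r * (d + e - n) = r * (d - i) + r * (e - (n - i)))%N.
    by rewrite -mulnDr; congr (_ * _)%N; lia.
  exact: dhomogM.
rewrite coefM big1 // => i _; have le_in : (i <= n)%N by rewrite -ltnS.
have /orP[/andP[le_id pi]|/eqP->] := ph i; last by rewrite mul0r.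
have /orP[/andP[le_je qj]|/eqP->] := qh (n - i)%N; last by rewrite mulr0.
by lia.
Qed.

Lemma whomog_XsubC_exp (a : S) n : a \is r.-homog -> whomog n (('X - a%:P) ^+ n).
Proof.
move=> ah; elim: n => [|n IH]; first exact: whomog1.
rewrite exprS -add1n; apply: whomogM => // i.
rewrite coefB coefX coefC; case: i => [|[|i]] /=; rewrite ?subrr ?eqxx ?orbT //.
  by rewrite sub0r rpredN subn0 muln1 ah.
by rewrite subr0 muln0 dhomog1.
Qed.

Lemma whomog_prod (I : Type) (s : seq I) (P : pred I) (F : I -> {poly S}) d :
  (forall i, P i -> whomog (d i) (F i)) ->
  whomog (\sum_(i <- s | P i) d i) (\prod_(i <- s | P i) F i).
Proof.
move=> Fh; elim/big_rec2: _ => [|i m p Pi]; first exact: whomog1.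
by move=> ph; apply: whomogM => //; apply: Fh.
Qed.

Lemma whomog_wint_horner d p (w : nat -> R) (a : S) :
  whomog d p -> a \is r.-homog ->
  (wint (fun n => (w n)%:A) p).[a] \is (r * d).-homog.
Proof.
move=> ph ah; rewrite horner_coef; apply: rpred_sum => i _.
rewrite coef_wint; have /orP[/andP[le_id pi]|/eqP->] := ph i; last first.
  by rewrite mulr0 mul0r rpred0.
have -> : (r * d = r * (d - i) + r * i)%N by rewrite -mulnDr subnK.
by rewrite mulr_algl dhomogM ?dhomogZ ?dhomogMn.
Qed.

End WeightedHomogeneous.

(** * Coefficients of the derivations *)

Section Rows.
Variables (K : numFieldType) (l r m : nat).
Hypothesis r_gt1 : (1 < r)%N.
Notation S := {mpoly K[l]}.

(* [weight] never divides by 0, as the shift is -1 modulo r. *)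
Definition shift : nat := (r * m + r.-1)%N.
Definition weight (n : nat) : K := ((r * n)%:R - shift%:R)^-1.

Lemma weightP n : weight n * ((r * n)%:R - shift%:R) = 1.
Proof.
rewrite /weight mulVf // subr_eq0 eqr_nat /shift; apply/eqP=> E.
have := congr1 (modn^~ r) E; rewrite modnMr mulnC modnMDl modn_small; lia.
Qed.

Definition integrand (A : nat) (mu : 'I_l -> nat) : {poly S} :=
  'X^A * \prod_i ('X - ('X_i ^+ r)%:P) ^+ mu i.

(** This is x_j^shift F(x_j), where F is the antiderivative of t^(-r (m + 1)) E(t^r) and E is the
    [integrand]; the factor clears the negative powers of x_j. [A] stands for N + s. *)
Definition integral (A : nat) (mu : 'I_l -> nat) (j : 'I_l) : S :=
  (wint (fun n => (weight n)%:A) (integrand A mu)).['X_j ^+ r].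

(** The weights that [wint_factor] leaves once the power of x_j is taken out. *)
Definition cofactor_weight (A mu n : nat) : K :=
  \sum_(i < mu.+1) 'C(mu, i)%:R * (-1) ^+ (mu - i) * weight (A + i + n)%N.

Definition reduced_integral (A : nat) (mu : 'I_l -> nat) (j : 'I_l) : S :=
  (wint (fun n => (cofactor_weight A (mu j) n)%:A)
        (\prod_(i | i != j) ('X - ('X_i ^+ r)%:P) ^+ mu i)).['X_j ^+ r].

Lemma integralE A mu j :
  integral A mu j = 'X_j ^+ (r * (A + mu j)) * reduced_integral A mu j.
Proof.
have wE n : \sum_(i < (mu j).+1) 'C(mu j, i)%:R * (-1) ^+ (mu j - i) *
    (weight (A + i + n))%:A = (cofactor_weight A (mu j) n)%:A :> S.
  rewrite -[RHS]/(in_alg S _) rmorph_sum; apply: eq_bigr => i _.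
  by rewrite !rmorphM !rmorphXn !rmorphN1 !rmorph_nat.
rewrite /integral /integrand (bigD1 j isT) wint_factor [in RHS]exprM.
by rewrite (eq_wint _ wE).
Qed.

Lemma reduced_integral_homog A mu j :
  reduced_integral A mu j \is (r * \sum_(i | i != j) mu i).-homog.
Proof.
have Xr (i : 'I_l) : ('X_i ^+ r : S) \is r.-homog.
  by rewrite -[X in X.-homog]mul1n dhomogMn ?mpolyX_homog.
apply: whomog_wint_horner => //; apply: whomog_prod => i _.
exact: whomog_XsubC_exp.
Qed.

Section OneRow.
Variables (z : K) (prim_z : r.-primitive_root z).

(** Apply [wint_difference_dvd] between x_a and z^k x_b; the latter has the same r-th power as x_b,
    so the integrand is the same. *)
Lemma integral_difference_dvd A mu (a b : 'I_l) (k : nat) : a != b ->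
  rdvd (('X_a - z ^+ k *: 'X_b) ^+ (mu a + mu b).+1)
       ('X_b ^+ shift * integral A mu a
        - z ^+ k *: ('X_a ^+ shift * integral A mu b)).
Proof.
move=> ne_ab; pose w' : S := z ^+ k *: 'X_b.
have w'r : w' ^+ r = 'X_b ^+ r.
  by rewrite /w' exprZn -exprM mulnC exprM (prim_expr_order prim_z) expr1n scale1r.
pose G : {poly S} :=
  'X^A * \prod_(i | (i != a) && (i != b)) ('X - ('X_i ^+ r)%:P) ^+ mu i.
have EE : integrand A mu =
    ('X - ('X_a ^+ r)%:P) ^+ mu a * (('X - (w' ^+ r)%:P) ^+ mu b * G).
  have ne_ba : b != a by rewrite eq_sym.
  have mulACA (x y u v : {poly S}) : x * (y * (u * v)) = y * (u * (x * v)) by ring.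
  rewrite w'r /integrand (bigD1 a isT) (bigD1 b ne_ba) mulACA /G.
  by congr (_ * (_ * (_ * _))); apply: eq_bigl.
have := wint_difference_dvd (mu a) (mu b) 'X_a w' G weightP.
rewrite -EE w'r /integral.
move: (_).['X_a ^+ r] (_).['X_b ^+ r] => Ia Ib.
(* Since shift + 1 = r (m + 1), the scalar z^(k (shift + 1)) is 1; this is the rule F(zeta t) = zeta
   F(t). *)
move=> /(rdvd_mull (z ^+ k)%:MP); rewrite mul_mpolyC scalerBr.
suff -> : z ^+ k *: (w' ^+ shift * Ia) = 'X_b ^+ shift * Ia by [].
rewrite /w' exprZn -scalerAl scalerA -exprM -exprD -mulnS /shift.
have -> : (r * m + r.-1).+1 = (r * m.+1)%N by rewrite -addnS prednK ?mulnSr //; lia.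
by rewrite mulnCA exprM (prim_expr_order prim_z) expr1n scale1r.
Qed.

Variables (A : nat) (mu : 'I_l -> nat) (P : S) (G : 'I_l -> S).
Hypothesis GE : forall j, G j * 'X_j ^+ shift = P * 'X_j ^+ (r * (A + mu j)).

(** By [GE] this is P F(x_j). The exponent r (A + mu j) - shift of x_j in F(x_j) may be negative,
    and P has to make up for it. *)
Definition row_coef (j : 'I_l) : S := G j * reduced_integral A mu j.

Lemma row_coefE j : row_coef j * 'X_j ^+ shift = P * integral A mu j.
Proof. by rewrite /row_coef mulrAC GE integralE mulrA. Qed.

(** After multiplication by x_a^shift x_b^shift this is the divisibility for the integrals. The
    linear form is prime and divides no variable, so both powers cancel. *)
Lemma row_coef_difference_dvd (a b : 'I_l) (k : 'I_r) : (a < b)%N ->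
  rdvd (('X_a - z ^+ k *: 'X_b) ^+ (mu a + mu b).+1)
       (row_coef a - z ^+ k *: row_coef b).
Proof.
move=> lt_ab; have ne_ab : a != b by rewrite -val_eqE /= ltn_eqF.
have fE : 'X_a - z ^+ k *: 'X_b = factor_form z (inr (a, b, k)) :> S by [].
have in_f : inr (a, b, k) \in factors l r by rewrite mem_factors.
have fpr : is_prime ('X_a - z ^+ k *: 'X_b : S).
  rewrite fE; apply: linear_form_prime; first exact: factor_form_homog.
  exact: factor_form_neq0.
have ndvdX (i : 'I_l) : ~ rdvd ('X_a - z ^+ k *: 'X_b : S) ('X_i ^+ shift).
  case/(prime_rdvd_exp fpr) => _; rewrite fE.
  have in_i : inl i \in factors l r by rewrite mem_factors.
  by move=> /(factor_inj (factor_form_sep prim_z) in_f in_i).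
apply: (rdvd_exp_prime fpr (ndvdX a)); apply: (rdvd_exp_prime fpr (ndvdX b)).
have -> : 'X_b ^+ shift * ('X_a ^+ shift * (row_coef a - z ^+ k *: row_coef b)) =
  P * ('X_b ^+ shift * integral A mu a
        - z ^+ k *: ('X_a ^+ shift * integral A mu b)).
  rewrite !mulrBr -!scalerAr; congr (_ - _ *: _).
    by rewrite mulrCA [P * _]mulrCA -row_coefE; ring.
  by rewrite [P * _]mulrCA -row_coefE; ring.
exact/rdvd_mull/integral_difference_dvd.
Qed.

End OneRow.

(** * Linear relations between the rows at a point *)

Section Determinant.
Variables (A : 'I_l -> nat) (mu : 'I_l -> 'I_l -> nat) (P : 'I_l -> S).
Variable G : 'I_l -> 'I_l -> S.
Hypothesis GE : forall k j,
  G k j * 'X_j ^+ shift = P k * 'X_j ^+ (r * (A k + mu k j)).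

Definition row_matrix : 'M[S]_l :=
  \matrix_(k, j) row_coef (A k) (mu k) (G k) j.

(** The coordinates 1, ..., l are positive and distinct, hence so are their r-th powers. *)
Definition point (j : 'I_l) : K := j.+1%:R.

(** At the point the matrix has scalar entries, and a vector of its left kernel combines the rows
    into one antiderivative that vanishes at all coordinates. *)
Lemma row_matrix_kernel : \det row_matrix = 0 ->
  exists2 u : 'I_l -> K, (exists k, u k != 0) &
  forall j, (wint weight (\sum_k (u k * (P k).@[point]) *:
    ('X^(A k) * \prod_i ('X - (point i ^+ r)%:P) ^+ mu k i))).[point j ^+ r] = 0.
Proof.
move=> /(congr1 (meval point)); rewrite meval0 -det_map_mx => /eqP/det0P[u u0 uM].
exists (fun k => u 0 k).
  apply/existsP; apply: contraNT u0 => /existsPn u0; apply/eqP/rowP=> k.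
  by rewrite mxE; apply/eqP/negPn/u0.
move=> j; rewrite linear_sum horner_sum.
(* The factor with exponent [shift] turns each entry of column j into [P k] times the integral. *)
have /(congr1 (fun x : 'rV_l => x 0 j * point j ^+ shift)) := uM.
rewrite !mxE mul0r => E; rewrite -{}[RHS]E mulr_suml; apply: eq_bigr => k _.
rewrite linearZ /= hornerZ -!mulrA; congr (_ * _); rewrite !mxE.
have := congr1 (meval point) (row_coefE (GE k) j).
rewrite !mevalM rmorphXn /= mevalXU => ->; congr (_ * _).
rewrite /integral -horner_map /= map_wint /= rmorphXn /= mevalXU.
congr (_.[_]); rewrite /integrand rmorphM rmorph_prod /= map_polyXn.
have -> : \prod_i map_poly (meval point) (('X - ('X_i ^+ r)%:P) ^+ mu k i) =
          \prod_i ('X - (point i ^+ r)%:P) ^+ mu k i.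
  apply: eq_bigr => i _; rewrite rmorphXn /= map_polyXsubC /=.
  by rewrite rmorphXn /= mevalXU.
by apply: eq_wint => n /=; rewrite mevalZ meval1 mulr1.
Qed.

End Determinant.
End Rows.

Lemma bin2_double n : (2 * 'C(n, 2) = n * n.-1)%N.
Proof. by have := mul_bin_diag n 1; rewrite bin1. Qed.

(** * Exponents of the multi-arrangements *)

Section Exponents.
Variables (K : numFieldType) (l r m : nat) (z : K) (ms nn : 'I_l -> nat) (N : nat).
Hypothesis r_gt1 : (1 < r)%N.
Hypothesis prim_z : r.-primitive_root z.
(** Here N = q + 1, and [nn i] = m_i - q r - 1 is the remainder of m_i - 1 modulo r. Stating this
    with N stays within natural numbers even if q = -1, which happens when all m_i are 0. *)
Hypothesis msE : forall i, (ms i + r = N * r + 1 + nn i)%N.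
Hypothesis nn_lt : forall i, (nn i < r)%N.
Notation S := {mpoly K[l]}.

Lemma exponents_of_multi_poly e (M : 'M[S]_l) (d : 'I_l -> nat) (es : seq int)
    (A : multiarrangement K l) :
  defining_poly A = multi_poly K r ms e ->
  (forall k j, rdvd ('X_j ^+ ms j) (M k j)) ->
  (forall k (a b : 'I_l) (i : 'I_r), (a < b)%N ->
     rdvd (('X_a - z ^+ i *: 'X_b) ^+ e) (M k a - z ^+ i *: M k b)) ->
  (forall k j, M k j \is (d k).-homog) ->
  \det M != 0 -> (\sum_k d k = \sum_i ms i + e * r * 'C(l, 2))%N ->
  [seq (d k)%:Z | k <- enum 'I_l] = es ->
  is_free A /\ has_exponents A es.
Proof.
move=> AE Mx Md Mh detM sum_d es_d.
apply: (exponents_of_matrix (factors_uniq l r) _ _ (factor_form_sep prim_z)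
         (etrans AE (multi_poly_factors _ _ prim_z)) _ Mh detM).
- by move=> t _; apply: factor_form_homog.
- exact: factor_form_neq0.
- move=> k [i _|[[a b] i]] /=; first by rewrite der_ofX.
  rewrite mem_factors => lt_ab; rewrite der_of_difference.
  exact: Md.
- by rewrite sum_d sum_factor_mult.
- by rewrite es_d.
Qed.

Lemma multi_poly_arrangement e :
  exists A : multiarrangement K l, defining_poly A = multi_poly K r ms e.
Proof.
rewrite (multi_poly_factors _ _ prim_z).
apply: exists_arrangement; [exact: factors_uniq| |exact: factor_form_neq0|].
  by move=> t _; apply: factor_form_homog.
exact: factor_form_sep.
Qed.

Lemma homog_Xn (i : 'I_l) n : ('X_i ^+ n : S) \is n.-homog.
Proof. by rewrite -[X in X.-homog]mul1n dhomogMn ?mpolyX_homog. Qed.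

Lemma ms_le i : (ms i <= N * r)%N.
Proof. by have := msE i; have := nn_lt i; lia. Qed.

Lemma sum_msE : (\sum_i ms i + l * r = l * (N * r + 1) + \sum_i nn i)%N.
Proof.
have -> : (l * r = \sum_(i < l) r)%N by rewrite sum_nat_const card_ord.
rewrite -big_split /=; under eq_bigr => i _ do rewrite msE.
by rewrite big_split /= sum_nat_const card_ord.
Qed.

Lemma point_inj : injective (fun j : 'I_l => point K j ^+ r).
Proof.
move=> i j /eqP; rewrite /point eqrXn2 ?ler0n //; last by lia.
by rewrite eqr_nat eqSS => /eqP/val_inj.
Qed.

Lemma point_neq0 (j : 'I_l) : point K j ^+ r != 0.
Proof. by rewrite expf_neq0 // pnatr_eq0. Qed.

(** Taking out X^B shifts the weights by B, which the constant k of [wint_prod_eq0] absorbs; the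
    power itself is nonzero at the points. *)
Lemma prod_points_eq0 B n (W : {poly K}) : (size W <= l)%N ->
  (forall j : 'I_l, (wint (weight K r m)
     ('X^B * (W * \prod_(i < l) ('X - (point K i ^+ r)%:P) ^+ n))).[point K j ^+ r] = 0) ->
  W = 0.
Proof.
move=> szW W0.
apply: (wint_prod_eq0 point_inj point_neq0 (r := r)
  (k := (r * B)%:R - (shift r m)%:R) (m := n)
  (w := fun n => weight K r m (B + n)%N)) => //; first by lia.
  by move=> k; rewrite -[RHS](@weightP K _ m r_gt1 (B + k)) mulnDr natrD; congr (_ * _); ring.
move=> j; have /eqP := W0 j; rewrite wint_XnM hornerM hornerXn mulf_eq0.
by rewrite expf_eq0 (negPf (point_neq0 j)) andbF => /eqP.
Qed.

(** For m = 0 the integrand cannot be divided by t^r - y_k, but the derivations x_i^(m_i) d/dx_i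
    form a basis. *)
Lemma even_zero_exponents (A : multiarrangement K l) :
  defining_poly A = multi_poly K r ms 0 ->
  is_free A /\ has_exponents A [seq (ms k)%:Z | k <- enum 'I_l].
Proof.
move=> AE; pose M : 'M[S]_l := diag_mx (\row_i 'X_i ^+ ms i).
have ME k j : M k j = 'X_j ^+ ms j *+ (k == j).
  by rewrite !mxE; case: eqP => // ->.
apply: (exponents_of_multi_poly (M := M) (d := ms) AE) => //.
- by move=> k j; rewrite ME; exists (k == j)%:R; rewrite mulr_natl.
- by move=> k a b i _; eexists; rewrite expr0 mulr1.
- move=> k j; rewrite ME; case: eqP => [->|_]; rewrite ?homog_Xn ?mulr0n ?rpred0 //.
- rewrite det_diag; apply/prodf_neq0 => i _; rewrite mxE expf_neq0 //.
  exact: (factor_form_neq0 prim_z (t := inl i) (mem_factors _)).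
- by rewrite !mul0n addn0.
Qed.

(** * Even multiplicity 2m with m > 0 *)

Section Even.
Variable m' : nat.
Hypothesis mE : m = m'.+1.

(** Row k divides the integrand by t^r - y_k. The resulting power of x_j is N r + 1 for j different
    from k, but only N r + 1 - r for j = k, where [P k] raises it to m_k. *)
Let mu (k p : 'I_l) : nat := (m - (p == k))%N.
Let P (k : 'I_l) : S := 'X_k ^+ nn k.
Let G (k j : 'I_l) : S :=
  if j == k then 'X_k ^+ ms k else 'X_k ^+ nn k * 'X_j ^+ (N * r + 1).

Lemma even_GE k j :
  G k j * 'X_j ^+ shift r m = P k * 'X_j ^+ (r * (N.+1 + mu k j)).
Proof.
rewrite /G /P /mu /shift; case: eqP => [->|_]; last first.
  rewrite -mulrA -exprD; congr (_ * _ ^+ _).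
  by rewrite subn0 mulnDr mulnS [(N * r)%N]mulnC; lia.
rewrite -!exprD; congr (_ ^+ _); have := msE k.
rewrite mE subn1 /= mulnDr !mulnS [(N * r)%N]mulnC; lia.
Qed.

Lemma even_sum_mu k j :
  (\sum_(p | p != j) mu k p + (k != j) = l.-1 * m)%N.
Proof.
have -> : ((k != j) = \sum_(p | p != j) (p == k) :> nat)%N.
  rewrite big_mkcond /= (bigD1 k) //= eqxx big1 ?addn0; first by case: ifP.
  by move=> p /negPf->; case: ifP.
rewrite -big_split /= (eq_bigr (fun=> m)); last first.
  by move=> p _; rewrite /mu subnK // mE; case: eqP.
rewrite sum_nat_const cardC1 card_ord; congr (_ * _)%N.
Qed.

Lemma even_exponents (A : multiarrangement K l) :
  defining_poly A = multi_poly K r ms (2 * m) ->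
  is_free A /\
  has_exponents A [seq (ms k + r * (l.-1 * m))%:Z | k <- enum 'I_l].
Proof.
move=> AE; pose M := row_matrix r m (fun=> N.+1) mu G.
have ME k j : M k j = row_coef r m N.+1 (mu k) (G k) j by rewrite mxE.
apply: (exponents_of_multi_poly (M := M) (d := fun k => (ms k + r * (l.-1 * m))%N) AE) => //.
- move=> k j; rewrite ME; apply: rdvd_mulr; rewrite /G.
  case: eqP => [->|_]; first exact: rdvd_refl.
  by apply/rdvd_mull/rdvd_exp_le; have := ms_le j; lia.
- move=> k a b i lt_ab; rewrite !ME.
  apply: rdvd_trans (row_coef_difference_dvd r_gt1 prim_z (even_GE k) _ lt_ab).
  (* At most one of a and b equals k, so the two multiplicities add up to at least 2m - 1. *)
  apply: rdvd_exp_le; rewrite /mu mE.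
  have : a != b by rewrite -val_eqE /= ltn_eqF.
  by case: (a =P k) => [->|_]; case: (b =P k) => [->|_] /=; rewrite ?eqxx //; lia.
- move=> k j; rewrite ME /row_coef.
  have := reduced_integral_homog K r m N.+1 (mu k) j.
  have := even_sum_mu k j; rewrite /G [k == j]eq_sym.
  case: (j =P k) => [-> /=|_ /=].
    by rewrite addn0 => ->; apply: dhomogM; apply: homog_Xn.
  move=> <- redh; have -> : (ms k + r * (\sum_(p | p != j) mu k p + 1) =
    nn k + (N * r + 1) + r * \sum_(p | p != j) mu k p)%N.
    by have := msE k; rewrite mulnDr muln1; lia.
  by apply: dhomogM => //; apply: dhomogM; apply: homog_Xn.
- apply/eqP=> /(row_matrix_kernel even_GE)[u [k uk] uM].
  pose y (i : 'I_l) := point K i ^+ r; pose c k := u k * (P k).@[point K (l := l)].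
  (* The relation has the integrand X^(N+1) W \prod_i (X - y_i)^(m-1). W is a Lagrange interpolation
     sum of degree less than l: it must vanish, yet its value at y_k is a nonzero multiple of
     c_k. *)
  pose W := \sum_k c k *: \prod_(i | i != k) ('X - (y i)%:P).
  have W0 : W = 0.
    apply: (@prod_points_eq0 N.+1 m') => [|j].
      apply: (leq_trans (size_sum _ _ _)); apply/bigmax_leqP => i _.
      apply: (leq_trans (size_scale_leq _ _)).
      rewrite size_prod => [|p _]; last by rewrite polyXsubC_eq0.
      under eq_bigr => p _ do rewrite size_XsubC.
      by rewrite sum_nat_const cardC1 card_ord; have := ltn_ord i; lia.
    rewrite -[RHS](uM j); congr (_.[_]); congr wint.
    rewrite mulr_suml mulr_sumr; apply: eq_bigr => i _; rewrite -scalerAl -scalerAr.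
    congr (_ *: (_ * _)); rewrite [RHS](bigD1 i) //= /mu eqxx mE subn1 /=.
    rewrite [X in _ * X = _](bigD1 i) //= mulrCA; congr (_ * _).
    rewrite -big_split /=; apply: eq_bigr => p /negPf ->.
    by rewrite subn0 -exprS.
  have : W.[y k] = c k * \prod_(i | i != k) (y k - y i).
    rewrite /W horner_sum (bigD1 k) //= hornerZ horner_prod.
    rewrite [X in _ + X]big1 ?addr0 => [|i ne_ik]; last first.
      have ne_ki : k != i by rewrite eq_sym.
      by rewrite hornerZ horner_prod (bigD1 k ne_ki) /= hornerXsubC subrr mul0r mulr0.
    by congr (_ * _); apply: eq_bigr => i _; rewrite hornerXsubC.
  rewrite W0 horner0 => /esym/eqP; rewrite !mulf_eq0 (negPf uk) /=.
  case/orP; first by rewrite /P rmorphXn /= mevalXU expf_eq0 pnatr_eq0 andbF.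
  apply/negP/prodf_neq0 => i ne_ik; rewrite subr_eq0 (inj_eq point_inj) eq_sym //.
- rewrite big_split /= sum_nat_const card_ord; congr (_ + _)%N.
  by have := bin2_double l; nia.
Qed.

End Even.

(** * Odd multiplicity 2m + 1 *)

Section Odd.
Hypothesis l_gt0 : (0 < l)%N.

(** Row k is the case s = k, with the power (N + k - 1) r + 1 of x_j. This is at least m_j for k >
    0, but for k = 0 it falls short by nn j; as P is common to the whole row, it has to contain all
    the missing powers. *)
Let P (k : 'I_l) : S := if k == 0%N :> nat then \prod_i 'X_i ^+ nn i else 1.
Let G (k j : 'I_l) : S :=
  if k == 0%N :> nat then (\prod_(i | i != j) 'X_i ^+ nn i) * 'X_j ^+ ms j
  else 'X_j ^+ ((N + k.-1) * r + 1).

Definition odd_degree (k : nat) : nat :=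
  (if k == 0%N then \sum_i nn i + N * r + 1 + r * (l.-1 * m) - r
   else (N + k.-1) * r + 1 + r * (l.-1 * m))%N.

Lemma odd_degreeE k : (odd_degree k + r =
  (if k == 0%N then \sum_i nn i else 0) + (N * r + 1 + r * (l.-1 * m) + k * r))%N.
Proof.
rewrite /odd_degree; case: eqP => [->|/eqP]; last first.
  by case: k => // k _; rewrite /= !mulnDl mulSn; lia.
rewrite mul0n addn0 subnK ?addnA //.
(* The subtraction of r is not truncated, since nn j + N r + 1 = m_j + r for any j. *)
pose j := Ordinal l_gt0; rewrite (bigD1 j) //=; have := msE j.
by move: (r * (l.-1 * m))%N => X; lia.
Qed.

Lemma odd_GE k j :
  G k j * 'X_j ^+ shift r m = P k * 'X_j ^+ (r * (N + k + m)).
Proof.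
rewrite /G /P /shift; case: eqP => [->|/eqP k_gt0].
  rewrite [in RHS](bigD1 j) //= -mulrA -exprD mulrAC -exprD [LHS]mulrC.
  congr (_ ^+ _ * _); have := msE j.
  by rewrite addn0 mulnDr [(N * r)%N]mulnC; lia.
rewrite mul1r -exprD; congr (_ ^+ _).
case: (k : nat) k_gt0 => // k' _ /=.
have -> : (N + k'.+1 + m = (N + k' + m).+1)%N by lia.
by rewrite mulnS !mulnDr mulnDl [(N * r)%N]mulnC [(k' * r)%N]mulnC; lia.
Qed.

Lemma odd_exponents (A : multiarrangement K l) :
  defining_poly A = multi_poly K r ms (2 * m + 1) ->
  is_free A /\
  has_exponents A [seq (odd_degree k)%:Z | k <- iota 0 l].
Proof.
move=> AE; pose mu (k p : 'I_l) := m.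
pose M := row_matrix r m (fun k : 'I_l => N + k)%N mu G.
have ME k j : M k j = row_coef r m (N + k) (mu k) (G k) j by rewrite mxE.
have sum_mu j : (\sum_(i < l | i != j) m = l.-1 * m)%N.
  by rewrite sum_nat_const cardC1 card_ord.
apply: (exponents_of_multi_poly (M := M) (d := odd_degree) AE) => //.
- move=> k j; rewrite ME; apply: rdvd_mulr; rewrite /G.
  case: eqP => _; first exact/rdvd_mull/rdvd_refl.
  by apply: rdvd_exp_le; apply: leq_trans (ms_le j) _; rewrite mulnDl -addnA leq_addr.
- move=> k a b i lt_ab; rewrite !ME.
  apply: rdvd_trans (row_coef_difference_dvd r_gt1 prim_z (odd_GE k) _ lt_ab).
  by apply: rdvd_exp_le; rewrite /mu; lia.
- move=> k j; rewrite ME /row_coef.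
  have redh := reduced_integral_homog K r m (N + k) (mu k) j.
  rewrite /odd_degree /G -(sum_mu j); case: eqP => _; last first.
    by apply: dhomogM => //; apply: homog_Xn.
  have -> : (\sum_i nn i + N * r + 1 + r * (\sum_(i < l | i != j) m) - r =
    \sum_(i | i != j) nn i + ms j + r * \sum_(i < l | i != j) m)%N.
    rewrite [in LHS](bigD1 j) //=; have := msE j.
    by move: (r * _)%N (\sum_(i | i != j) nn i)%N => X Y; lia.
  apply: dhomogM => //; apply: dhomogM; last exact: homog_Xn.
  by apply: dhomog_prod_seq => i _; apply: homog_Xn.
- apply/eqP=> /(row_matrix_kernel odd_GE)[u [k uk] uM].
  pose c k := u k * (P k).@[point K (l := l)].
  (* Apart from P, the rows differ only by the power X^k in the integrand, so the relation
     multiplies the common integrand by W, whose coefficients are the c_k. *)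
  pose W := \sum_(k < l) c k *: 'X^k.
  have W0 : W = 0.
    apply: (@prod_points_eq0 N m) => [|j].
      apply: (leq_trans (size_sum _ _ _)); apply/bigmax_leqP => i _.
      by apply: (leq_trans (size_scale_leq _ _)); rewrite size_polyXn.
    rewrite -[RHS](uM j); congr (_.[_]); congr wint.
    rewrite mulr_suml mulr_sumr; apply: eq_bigr => i _.
    by rewrite -scalerAl -scalerAr exprD mulrA.
  have : W`_k = c k.
    rewrite /W coef_sum (bigD1 k) //= coefZ coefXn eqxx mulr1 big1 ?addr0 // => i ne_ik.
    by rewrite coefZ coefXn eq_sym -[_ == _]/(i == k) (negPf ne_ik) mulr0.
  rewrite W0 coef0 => /esym/eqP; rewrite mulf_eq0 (negPf uk) /P /=.
  case: ifP => _; last by rewrite meval1 oner_eq0.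
  apply/negP; rewrite rmorph_prod; apply/prodf_neq0 => i _.
  by rewrite rmorphXn /= mevalXU expf_neq0 // pnatr_eq0.
(* Adding r to each of the l degrees avoids the subtraction in [odd_degree]. *)
- apply: (@addIn (l * r)%N); rewrite /= [RHS]addnAC sum_msE.
  have -> : (l * r = \sum_(i < l) r)%N by rewrite sum_nat_const card_ord.
  rewrite -big_split /=; under eq_bigr => k _ do rewrite odd_degreeE.
  have sum_k : (\sum_(k < l) k * r = 'C(l, 2) * r)%N.
    by rewrite -big_distrl /= -triangular_sum big_mkord.
  rewrite !big_split /= -big_mkcond /= (big_pred1 (Ordinal l_gt0)) // sum_k.
  rewrite !sum_nat_const card_ord.
  by have := bin2_double l; move: (\sum_(i < l) nn i)%N => X; nia.
- by rewrite -val_enum_ord -map_comp.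
Qed.

End Odd.
End Exponents.

(** * Roots of unity and the integer form of the exponents *)

Lemma prim_root_exists (F : numClosedFieldType) n :
  (0 < n)%N -> exists z : F, n.-primitive_root z.
Proof.
move=> n_gt0; have [rs rsE] := closed_field_poly_normal ('X^n - 1 : {poly F}).
rewrite (monicP _) ?monicXnsubC // scale1r in rsE.
(* X^n - 1 is separable, so its n roots are distinct, and one of them must be primitive. *)
have /hasP[z _ prim_z] : has n.-primitive_root rs; last by exists z.
apply: has_prim_root => //.
- by apply/allP=> z; rewrite -root_prod_XsubC -rsE.
- by rewrite -separable_prod_XsubC -rsE separable_Xn_sub_1 // pnatr_eq0 -lt0n.
- have := congr1 (size \o polyseq) rsE; rewrite /= size_prod_XsubC size_XnsubC //.
  by case=> ->.
Qed.

Theorem theorem4p1 (R : realType) (r l m : nat) (ms : 'I_l -> nat) (q : int)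
    (hr : (2 <= r)%N) (hl : (2 <= l)%N)
    (hq : forall i : 'I_l, (((ms i)%:Z - 1) %/ r%:Z)%Z = q) :
  let a : int := (l%:Z - 1) * r%:Z in
  let m' : int := \sum_(i < l) (ms i)%:Z in
  let c : int := m%:Z * a + q * r%:Z + 1 in
  let Q1 : {mpoly (complex R)[l]} := multi_poly (complex R) r ms (2 * m) in
  let Q2 : {mpoly (complex R)[l]} := multi_poly (complex R) r ms (2 * m + 1) in
  let es1 : seq int := [seq m%:Z * a + (ms i)%:Z | i <- enum 'I_l] in
  let es2 : seq int :=
    (c + m' - l%:Z * (q * r%:Z + 1))
      :: [seq c + k%:Z * r%:Z | k <- iota 1 (l - 1)] in
  let es2' : seq int :=
    ((m%:Z - q) * a + m' - l%:Z + 1)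
      :: [seq m%:Z * a + (q + k%:Z) * r%:Z + 1 | k <- iota 1 (l - 1)] in
  ((exists A : multiarrangement (complex R) l, defining_poly A = Q1) /\
   (forall A : multiarrangement (complex R) l, defining_poly A = Q1 ->
      is_free A /\ has_exponents A es1)) /\
  ((exists A : multiarrangement (complex R) l, defining_poly A = Q2) /\
   (forall A : multiarrangement (complex R) l, defining_poly A = Q2 ->
      is_free A /\ has_exponents A es2) /\
   perm_eq es2 es2').
Proof.
have r_gt0 : (0 < r)%N by apply: leq_trans hr.
have l_gt0 : (0 < l)%N by apply: leq_trans hl.
have [z prim_z] := @prim_root_exists (complex R) r r_gt0.
move=> a m' c Q1 Q2 es1 es2 es2'.
(* Neither absolute value changes anything: q is at least -1 and remainders are nonnegative. *)
pose N := `|(q + 1)%R|%N; pose nn i := `|(((ms i)%:Z - 1) %% r%:Z)%Z|%N.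
have r0 : r%:Z != 0 by lia.
have divE i : (ms i)%:Z - 1 = q * r%:Z + (nn i)%:Z.
  by rewrite /nn gez0_abs ?modz_ge0 // -(hq i) -divz_eq.
have nn_lt i : (nn i < r)%N.
  by have := ltz_mod ((ms i)%:Z - 1) r0; rewrite /nn; lia.
have NE : N%:Z = q + 1.
  have i0 := Ordinal l_gt0; have := divE i0; have := nn_lt i0; rewrite /N; nia.
have msE i : (ms i + r = N * r + 1 + nn i)%N.
  by have := divE i; nia.
have aE : a = (l.-1 * r)%:Z by rewrite PoszM /a; congr (_ * _); lia.
split; split; first exact: (multi_poly_arrangement ms prim_z).
- move=> A AE; case: (posnP m) => [m0|m_gt0].
    have -> : es1 = [seq (ms k)%:Z | k <- enum 'I_l].
      by apply: eq_map => k; rewrite m0 mul0r add0r.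
    apply: (even_zero_exponents prim_z).
    by rewrite AE /Q1 m0 muln0.
  have -> : es1 = [seq (ms k + r * (l.-1 * m))%:Z | k <- enum 'I_l].
    by apply: eq_map => k; rewrite aE; lia.
  exact: (even_exponents hr prim_z msE nn_lt (esym (prednK m_gt0)) AE).
- exact: (multi_poly_arrangement ms prim_z).
split=> [A AE|].
  have dE k := odd_degreeE m hr prim_z msE l_gt0 k.
  have -> : es2 = [seq (odd_degree r m nn N k)%:Z | k <- iota 0 l].
    have -> : iota 0 l = 0%N :: iota 1 (l - 1) by rewrite -{1}(prednK l_gt0) subn1.
    have m'E : m' = (\sum_i ms i)%N%:Z by rewrite (big_morph Posz PoszD (erefl _)).
    have sumE := sum_msE msE.
    rewrite /es2 /c aE m'E; congr (_ :: _).
      (* The first exponent is c plus the sum of the nn i = m_i - q r - 1. *)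
      have := dE 0%N; rewrite eqxx mul0n addn0; nia.
    apply/eq_in_map => k; rewrite mem_iota => /andP[k_gt0 _].
    by have := dE k; rewrite gtn_eqF //; nia.
  exact: (odd_exponents hr prim_z msE nn_lt l_gt0 AE).
suff -> : es2 = es2' by [].
congr (_ :: _); first by rewrite /c /a; ring.
by apply: eq_map => k; rewrite /c; ring.
Qed.
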